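(* For every integer $g > 1$, the diameter of the generalized Bolza surface $S_g$ of genus $g$ is $$\mathscr{D}_g = \operatorname{arccosh}\left(\cot^2\left(\frac{\pi}{4g}\right)\right).$$
   Context: Let $\mathbb{D} = \{z \in \mathbb{C} : |z| < 1\}$ be the Poincaré disk model of the hyperbolic plane (curvature $-1$), with hyperbolic distance $\delta(z,w) = 2\,\mathrm{artanh}\left|\frac{z-w}{1-\bar z w}\right|$. A $2\times 2$ complex matrix $\begin{bmatrix} a & \bar c\\ c & \bar a\end{bmatrix}$ with $|a|>|c|$ (considered up to scaling) acts on $\mathbb{D}$ by $z \mapsto \frac{az+\bar c}{cz+\bar a}$. For an integer $g>1$, define $s>0$ and $R>0$ by $\cosh^2(s/2) = \cosh R = \cot^2(\pi/4g)$. Let $\mathscr{F}_g$ be the group of isometries of $\mathbb{D}$ generated by $$t_k = \begin{bmatrix} 1 & \tanh(s/2)\, e^{k\pi i/2g} \\ \tanh(s/2)\, e^{-k\pi i/2g} & 1 \end{bmatrix}, \quad k = 0,1,\dots,2g-1,$$ (a Fuchsian group). The generalized Bolza surface of genus $g$ is the quotient surface $S_g = \mathbb{D}/\mathscr{F}_g$; equivalently, it is the surface obtained by identifying opposite sides of the regular hyperbolic $4g$-gon centered at $0$ with interior angles $\pi/2g$, side length $s$, circumradius $R$, and vertices $v_k = \tanh(R/2)\, e^{(k-1/2)\pi i/2g}$, $k = 0,\dots,4g-1$, the identifications being given by the $t_k$. Points of $S_g$ are orbits $[z] = \mathscr{F}_g z$, and the distance on $S_g$ is $$\delta^\star([z],[w])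 = \inf\{\delta(z',w') : z' \in [z],\ w' \in [w]\}.$$ The diameter $\mathscr{D}_g$ of $S_g$ is the maximum of $\delta^\star([z],[w])$ over all $[z],[w]\in S_g$. *)

(* Defs.v *)
From Stdlib Require Import Reals Lra Lia.
From Coquelicot Require Import Coquelicot.
Open Scope R_scope.

Definition cot (x : R) : R := cos x / sin x.
Definition artanh (x : R) : R := ln ((1 + x) / (1 - x)) / 2.
(* Principal branch, meaningful for 1 <= x; see [arcosh_spec]. *)
Definition arcosh (x : R) : R := ln (x + sqrt (x ^ 2 - 1)).
Definition cis (t : R) : C := (cos t, sin t).

Lemma cosh_incr x y : 0 <= x -> x < y -> cosh x < cosh y.
Proof.
  intros Hx Hxy; unfold cosh; rewrite !exp_Ropp.
  assert (Ex : 1 <= exp x).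
  { destruct Hx as [Hx | <-]; [left; rewrite <- exp_0; now apply exp_increasing
                              | rewrite exp_0; lra]. }
  assert (Exy := exp_increasing _ _ Hxy).
  set (a := exp x) in *; set (b := exp y) in *.
  enough (0 < (b + / b) - (a + / a)) by lra.
  replace ((b + / b) - (a + / a)) with ((b - a) * (a * b - 1) / (a * b))
    by (field; lra).
  assert (1 < a * b) by nra.
  apply Rdiv_lt_0_compat; [apply Rmult_lt_0_compat |]; lra.
Qed.

Lemma cosh_inj x y : 0 <= x -> 0 <= y -> cosh x = cosh y -> x = y.
Proof.
  intros Hx Hy E; destruct (Rtotal_order x y) as [H | [H | H]]; auto.
  - generalize (cosh_incr x y Hx H); lra.
  - generalize (cosh_incr y x Hy H); lra.
Qed.

Lemma arcosh_spec x : 1 <= x -> 0 <= arcosh x /\ cosh (arcosh x) = x.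
Proof.
  intros Hx; unfold arcosh.
  assert (Hs := sqrt_pos (x ^ 2 - 1)).
  assert (Hq : sqrt (x ^ 2 - 1) * sqrt (x ^ 2 - 1) = x ^ 2 - 1)
    by (apply sqrt_sqrt; nra).
  set (q := sqrt (x ^ 2 - 1)) in *; split.
  - rewrite <- ln_1; apply ln_le; lra.
  - unfold cosh; rewrite exp_Ropp, exp_ln by lra.
    replace (/ (x + q)) with (x - q); [lra |].
    apply Rmult_eq_reg_l with (x + q); [rewrite Rinv_r |]; nra.
Qed.

Definition disk : Type := {z : C | Cmod z < 1}.
Definition pt (z : disk) : C := proj1_sig z.

Definition hdist (z w : disk) : R :=
  2 * artanh (Cmod ((pt z - pt w) / (1 - Cconj (pt z) * pt w))%C).

(* The matrix with rows (ma, conj mc) and (mc, conj ma). *)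
Record disk_mx := DiskMx { ma : C; mc : C; disk_mxP : Cmod mc < Cmod ma }.

Lemma Cmod_lt_of_sqr x y : Cmod x ^ 2 < Cmod y ^ 2 -> Cmod x < Cmod y.
Proof. intros H; generalize (Cmod_ge_0 x) (Cmod_ge_0 y); nra. Qed.

Lemma Cmod_mobius (a c z : C) :
  Cmod (c * z + Cconj a)%C ^ 2 - Cmod (a * z + Cconj c)%C ^ 2
  = (Cmod a ^ 2 - Cmod c ^ 2) * (1 - Cmod z ^ 2).
Proof.
  destruct a as [a1 a2], c as [c1 c2], z as [z1 z2].
  rewrite !Cmod2_alt; simpl; ring.
Qed.

Lemma Cmod_quot_lt1 (u v : C) : Cmod u < Cmod v -> Cmod (u / v)%C < 1.
Proof.
  intros H; assert (Hu := Cmod_ge_0 u).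
  assert (Hv : v <> RtoC 0) by (apply Cmod_gt_0; lra).
  rewrite Cmod_div by assumption.
  apply Rmult_lt_reg_r with (Cmod v); [lra |].
  unfold Rdiv; rewrite Rmult_assoc, Rinv_l; lra.
Qed.

Lemma mobius_in_disk (m : disk_mx) (z : disk) :
  Cmod ((ma m * pt z + Cconj (mc m)) / (mc m * pt z + Cconj (ma m)))%C < 1.
Proof.
  destruct m as [a c Hm], z as [z Hz]; simpl.
  apply Cmod_quot_lt1, Cmod_lt_of_sqr.
  assert (E := Cmod_mobius a c z).
  assert (0 < Cmod a ^ 2 - Cmod c ^ 2) by (generalize (Cmod_ge_0 c); nra).
  assert (0 < 1 - Cmod z ^ 2) by (assert (P := Cmod_ge_0 z); clear - P Hz; nra).
  nra.
Qed.

Definition mobius (m : disk_mx) (z : disk) : disk :=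
  exist _ _ (mobius_in_disk m z).

(* The subgroup, under composition, of the bijections of X generated by S. *)
Inductive generated {X : Type} (S : (X -> X) -> Prop) : (X -> X) -> Prop :=
| gen_id : generated S (fun x => x)
| gen_base f : S f -> generated S f
| gen_comp f h : generated S f -> generated S h ->
    generated S (fun x => f (h x))
| gen_inv f h : generated S f ->
    (forall x, h (f x) = x) -> (forall x, f (h x) = x) -> generated S h.

(* The positive solution s of cosh^2 (s/2) = cot^2 (PI/4g); see [side_spec]. *)
Definition side (g : nat) : R := 2 * arcosh (cot (PI / (4 * INR g))).

Lemma cot_gt1 g : (1 < g)%nat -> 1 < cot (PI / (4 * INR g)).
Proof.
  intros Hg; assert (H2 : 2 <= INR g) by (apply (le_INR 2); lia).
  assert (HP := PI_RGT_0); unfold cot.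
  assert (H0 : 0 < PI / (4 * INR g)) by (apply Rdiv_lt_0_compat; lra).
  assert (H4 : PI / (4 * INR g) < PI / 4).
  { apply Rmult_lt_compat_l; [lra |]; apply Rinv_lt_contravar; nra. }
  set (x := PI / (4 * INR g)) in *.
  assert (Hs : 0 < sin x) by (apply sin_gt_0; lra).
  assert (Hc : sin x < cos x).
  { apply Rlt_trans with (sin (PI / 4)); [apply sin_increasing_1; lra |].
    rewrite sin_cos_PI4; apply cos_decreasing_1; lra. }
  apply Rmult_lt_reg_r with (sin x); [lra |].
  unfold Rdiv; rewrite Rmult_assoc, Rinv_l; lra.
Qed.

Lemma side_spec g s : (1 < g)%nat ->
  (0 < s /\ cosh (s / 2) ^ 2 = cot (PI / (4 * INR g)) ^ 2) <-> s = side g.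
Proof.
  intros Hg; assert (Hc := cot_gt1 g Hg); unfold side.
  set (c := cot _) in *.
  destruct (arcosh_spec c) as [Ha Ea]; [lra |].
  assert (Hpos : 0 < arcosh c).
  { destruct Ha as [Ha | Ha]; auto; rewrite <- Ha, cosh_0 in Ea; lra. }
  split.
  - intros [Hs E].
    assert (0 < cosh (s / 2)) by
      (unfold cosh; generalize (exp_pos (s / 2)) (exp_pos (- (s / 2))); lra).
    enough (s / 2 = arcosh c) by lra.
    apply cosh_inj; [lra | lra | rewrite Ea; nra].
  - intros ->; split; [lra |].
    replace (2 * arcosh c / 2) with (arcosh c) by field.
    now rewrite Ea.
Qed.

Lemma Cmod_cis t : Cmod (cis t) = 1.
Proof.
  unfold Cmod, cis; simpl fst; simpl snd.
  replace (cos t ^ 2 + sin t ^ 2) with 1; [apply sqrt_1 |].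
  generalize (sin2_cos2 t); unfold Rsqr; lra.
Qed.

Lemma Rabs_tanh_lt1 x : Rabs (tanh x) < 1.
Proof.
  unfold tanh, sinh, cosh; assert (H := exp_pos x); assert (H' := exp_pos (- x)).
  replace ((exp x - exp (- x)) / 2 / ((exp x + exp (- x)) / 2))
    with ((exp x - exp (- x)) / (exp x + exp (- x))) by (field; lra).
  apply Rabs_def1; apply Rmult_lt_reg_r with (exp x + exp (- x)); try lra;
    unfold Rdiv; rewrite Rmult_assoc, Rinv_l; lra.
Qed.

Lemma t_mxP (g k : nat) :
  Cmod (tanh (side g / 2) * cis (- (INR k * PI / (2 * INR g))))%C
  < Cmod (RtoC 1).
Proof.
  rewrite Cmod_mult, Cmod_cis, Cmod_R, Cmod_1, Rmult_1_r.
  apply Rabs_tanh_lt1.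
Qed.

Definition t_mx (g k : nat) : disk_mx := DiskMx _ _ (t_mxP g k).

Definition bolza_group (g : nat) : (disk -> disk) -> Prop :=
  generated (fun f => exists k, (k < 2 * g)%nat /\ f = mobius (t_mx g k)).

Definition orbit (g : nat) (z : disk) : disk -> Prop :=
  fun w => exists f, bolza_group g f /\ w = f z.

Definition surface (g : nat) : Type :=
  {P : disk -> Prop | exists z, P = orbit g z}.

Definition on {g : nat} (p : surface g) (z : disk) : Prop := proj1_sig p z.

Definition orbit_dists {g : nat} (p q : surface g) : R -> Prop :=
  fun d => exists z w, on p z /\ on q w /\ d = hdist z w.

(* [real] loses no information here: see [sdist_glb]. *)
Definition sdist {g : nat} (p q : surface g) : R :=
  real (Glb_Rbar (orbit_dists p q)).

Lemma hdist_ge0 z w : 0 <= hdist z w.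
Proof.
  destruct z as [z Hz], w as [w Hw]; unfold hdist, pt, artanh; simpl proj1_sig.
  assert (H : Cmod ((z - w) / (1 - Cconj z * w))%C < 1).
  { apply Cmod_quot_lt1, Cmod_lt_of_sqr.
    assert (0 < 1 - Cmod z ^ 2) by (assert (P := Cmod_ge_0 z); clear - P Hz; nra).
    assert (0 < 1 - Cmod w ^ 2) by (assert (P := Cmod_ge_0 w); clear - P Hw; nra).
    assert (E : Cmod (1 - Cconj z * w)%C ^ 2 - Cmod (z - w)%C ^ 2
                = (1 - Cmod z ^ 2) * (1 - Cmod w ^ 2)).
    { destruct z as [z1 z2], w as [w1 w2]; rewrite !Cmod2_alt; simpl; ring. }
    nra. }
  assert (H0 := Cmod_ge_0 ((z - w) / (1 - Cconj z * w))%C).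
  set (x := Cmod ((z - w) / (1 - Cconj z * w))%C) in *.
  enough (0 <= ln ((1 + x) / (1 - x))) by lra.
  rewrite <- ln_1; apply ln_le; [lra |].
  apply Rmult_le_reg_r with (1 - x); [lra |].
  unfold Rdiv; rewrite Rmult_assoc, Rinv_l; lra.
Qed.

Lemma sdist_glb g (p q : surface g) :
  is_glb_Rbar (orbit_dists p q) (Finite (sdist p q)).
Proof.
  unfold sdist; assert (G := Glb_Rbar_correct (orbit_dists p q)).
  enough (is_finite (Glb_Rbar (orbit_dists p q))) as -> by exact G.
  destruct G as [Glb Ggr].
  assert (H0 : Rbar_le (Finite 0) (Glb_Rbar (orbit_dists p q))).
  { apply Ggr; intros d (z & w & _ & _ & ->); apply hdist_ge0. }
  destruct p as [P [z Ez]], q as [Q [w Ew]].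
  assert (H1 : Rbar_le (Glb_Rbar (orbit_dists (exist _ P (ex_intro _ z Ez))
                 (exist _ Q (ex_intro _ w Ew)))) (Finite (hdist z w))).
  { apply Glb; exists z, w; repeat split; unfold on; simpl; [rewrite Ez | rewrite Ew];
      exists (fun x => x); split; auto; apply gen_id. }
  destruct (Glb_Rbar _); simpl in *; try easy.
Qed.

Definition is_diameter (g : nat) (D : R) : Prop :=
  (exists p q : surface g, sdist p q = D) /\
  (forall p q : surface g, sdist p q <= D).

(* Main.v *)
(* In the hyperboloid model put c = cot (PI/4g) = cosh (s/2), so that c^2 = cosh R.
   Vertex and centre of the polygon are exchanged by a reflection normalising the group.

   Upper bound. Replace z by a point of its orbit (almost) nearest to the centre 0, and w
   by a point of its orbit (almost) nearest to a vertex v. By the above symmetry assume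
   d(w, v) <= d(z, 0). Let [v v'] be the side of the polygon seen from 0 in the direction
   of z; the translation along that side taking v to v' lies in the group. Then w and its
   image w' under it satisfy min (d(z, w), d(z, w')) <= R: a suitable convex combination of
   the two values of cosh is bounded by Cauchy-Schwarz, the bound increases with d(w, v),
   and at d(w, v) = d(z, 0) it is at most c^2 exactly because z lies in the sector.

   Lower bound. The group lies in the triangle reflection group (2, 4g, 4g) generated by
   the sides of the triangle with vertices 0, v and the midpoint of an adjacent side. By
   the argument of Tits, if w is shorter than w s_i then w maps the simple root e_i to a
   nonnegative combination of simple roots; since 0 and v lie in the closed fundamental
   chamber, lengthening a reduced word can only increase d(0, w v), which is therefore at
   least d(0, v) = R. *)

Require Import Defs.
From Stdlib Require Import Reals Lra Lia Psatz ZArith List Nsatz.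
From Coquelicot Require Import Coquelicot.
Open Scope R_scope.

(** * The distance estimate *)

(** For [Rabs m <= 1] the number [A + m * B] is a convex combination of [A + B] and [A - B], so the
    smaller of the two does not exceed it. *)
Lemma convex_min_le m A B T :
  Rabs m <= 1 -> A + m * B <= T -> A + B <= T \/ A - B <= T.
Proof.
  intros Hm H; apply Rabs_le_between in Hm.
  destruct (Rle_dec 0 B); [right | left]; nra.
Qed.

Lemma cauchy2 a b x y p q :
  0 <= p -> 0 <= q -> a ^ 2 + b ^ 2 = p ^ 2 -> x ^ 2 + y ^ 2 = q ^ 2 ->
  a * x + b * y <= p * q.
Proof.
  intros Hp Hq Ha Hx.
  apply Rsqr_incr_0_var; [| nra].
  unfold Rsqr.
  assert (0 <= (a * y - b * x) ^ 2) by apply pow2_ge_0.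
  assert ((p * q) * (p * q) = (a ^ 2 + b ^ 2) * (x ^ 2 + y ^ 2))
    by (rewrite Ha, Hx; ring).
  nra.
Qed.

(** Squaring the sector condition and eliminating [z] gives the quadratic bound. Multiplied by
    [s ^ 2] and combined with [c * y <= s * k] it yields [y <= s]; the last bound follows from these
    two and [1 + y ^ 2 <= k ^ 2]. *)
Lemma sector_bounds c s k y z :
  0 < s -> 0 < c -> c ^ 2 = 1 + s ^ 2 -> 0 < k -> k ^ 2 = 1 + y ^ 2 + z ^ 2 -> 0 <= y ->
  c * Rabs z <= s * k - c * y ->
  y <= s /\ k ^ 2 + 2 * c * s * k * y <= c ^ 2 * (1 + 2 * y ^ 2) /\
  c * k * y <= s * (1 + y ^ 2).
Proof.
  intros Hs Hc Hcs Hk Hz Hy Hsec.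
  assert (Ha := Rabs_pos z).
  assert (Hz2 : z ^ 2 = Rabs z ^ 2) by (rewrite pow2_abs; ring).
  set (a := Rabs z) in *.
  assert (Hq : k ^ 2 + 2 * c * s * k * y <= c ^ 2 * (1 + 2 * y ^ 2)).
  { assert (c * a * (c * a) <= (s * k - c * y) * (s * k - c * y)).
    { apply Rmult_le_compat; nra. }
    assert (c ^ 2 * a ^ 2 = c ^ 2 * k ^ 2 - c ^ 2 - c ^ 2 * y ^ 2) by (rewrite <- Hz2; nra).
    assert (s ^ 2 * k ^ 2 = c ^ 2 * k ^ 2 - k ^ 2) by (rewrite Hcs; ring).
    nra. }
  assert (Hsk : c * y <= s * k) by nra.
  assert (Hys : y <= s).
  { assert (k * (c * y) <= k * (s * k)) by (apply Rmult_le_compat_l; lra).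
    assert (c * y * (c * y) <= s * k * (s * k)) by (apply Rmult_le_compat; nra).
    assert (s ^ 2 * (k ^ 2 + 2 * c * s * k * y) <= s ^ 2 * (c ^ 2 * (1 + 2 * y ^ 2)))
      by (apply Rmult_le_compat_l; [apply pow2_ge_0 | exact Hq]).
    assert (s ^ 2 * (c * y * (c * y)) <= s ^ 2 * (c * y * (s * k))).
    { apply Rmult_le_compat_l; [apply pow2_ge_0 |].
      apply Rmult_le_compat_l; [nra | lra]. }
    assert (c ^ 2 * y ^ 2 <= c ^ 2 * s ^ 2) by nra.
    assert (y ^ 2 <= s ^ 2) by (apply Rmult_le_reg_l with (c ^ 2); nra).
    nra. }
  split; [exact Hys | split; [exact Hq |]].
  assert (y ^ 2 <= s ^ 2) by nra.
  assert (0 <= z ^ 2) by apply pow2_ge_0.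
  assert (2 * s * (c * k * y) <= 2 * s * (s * (1 + y ^ 2))) by nra.
  nra.
Qed.

(* The coordinates are such that a side of the polygon has midpoint [(1, 0, 0)] and lies
   where the middle coordinate vanishes. The first point is [(k, - y, z)], the two
   candidates for the second one are [(w0, w1, w2)] translated along the side by plus and
   minus half its length, and [c * k - s * y] is cosh of the distance from the first point
   to the centre. *)
Lemma key_inner c s k y z w0 w1 w2 :
  0 < s -> 0 < c -> c ^ 2 = 1 + s ^ 2 -> 0 < k -> k ^ 2 = 1 + y ^ 2 + z ^ 2 -> 0 <= y ->
  c * Rabs z <= s * k - c * y ->
  1 <= w0 -> w0 ^ 2 = 1 + w1 ^ 2 + w2 ^ 2 -> w0 <= c * k - s * y ->
  exists m, Rabs m <= 1 /\
    c * k * w0 - c * z * w2 + y * w1 + m * (s * (k * w2 - z * w0)) <= c ^ 2.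
Proof.
  intros Hs Hc Hcs Hk Hz Hy Hsec Hw0 Hw Hwz.
  destruct (sector_bounds c s k y z) as (Hys & Hq & Hl); auto.
  set (z0 := c * k - s * y) in *.
  assert (Hz0k : z0 <= c * k) by (unfold z0; nra).
  (* In the frame of the centre of the polygon the first point is [(z0, u, z)], whence [Hz0]
     below. *)
  set (u := s * k - c * y) in *.
  assert (Ha := Rabs_pos z).
  assert (Hu : 0 <= u) by nra.
  assert (Hz2 : z ^ 2 = Rabs z ^ 2) by (rewrite pow2_abs; ring).
  assert (Hz0 : z0 ^ 2 - 1 = z ^ 2 + u ^ 2).
  { unfold z0, u. replace (z ^ 2) with (k ^ 2 - 1 - y ^ 2) by lra.
    replace (s ^ 2) with (c ^ 2 - 1) by lra.
    enough ((c ^ 2 - s ^ 2) * (k ^ 2 - y ^ 2) = k ^ 2 - y ^ 2) by nra.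
    rewrite Hcs; ring. }
  assert (Hzu : c ^ 2 * z ^ 2 <= u ^ 2)
    by (rewrite Hz2, <- Rpow_mult_distr; apply pow_incr; split; [nra | exact Hsec]).
  assert (HD2 : (1 + y ^ 2) * z0 ^ 2 - k ^ 2 = k ^ 2 * (z ^ 2 + u ^ 2) - z ^ 2 * z0 ^ 2)
    by (rewrite <- Hz0; replace (1 + y ^ 2) with (k ^ 2 - z ^ 2) by lra; ring).
  assert (Hz0k2 : z0 ^ 2 <= c ^ 2 * k ^ 2)
    by (rewrite <- Rpow_mult_distr; apply pow_incr; split; lra).
  set (D2 := (1 + y ^ 2) * z0 ^ 2 - k ^ 2) in *.
  assert (HzD : z ^ 2 * z0 ^ 2 <= c ^ 2 * D2).
  { rewrite HD2.
    assert (H1 : (1 + c ^ 2) * (z ^ 2 * z0 ^ 2) <= (1 + c ^ 2) * (z ^ 2 * (c ^ 2 * k ^ 2)))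
      by (apply Rmult_le_compat_l; [| apply Rmult_le_compat_l]; try apply pow2_ge_0;
          generalize (pow2_ge_0 c); lra).
    assert (H2 : c ^ 2 * k ^ 2 * (c ^ 2 * z ^ 2) <= c ^ 2 * k ^ 2 * u ^ 2)
      by (apply Rmult_le_compat_l; [generalize (pow2_ge_0 (c * k)); nra | exact Hzu]).
    lra. }
  assert (HD2p : 0 <= D2).
  { assert (0 <= z ^ 2 * z0 ^ 2) by (generalize (pow2_ge_0 (z * z0)); nra). nra. }
  (* The difference is [s ^ 2] times an expression that the quadratic bound of [sector_bounds]
     bounds below by [y ^ 2 * (1 + c ^ 2) * z ^ 2]. *)
  assert (HD2b : D2 <= (c * (s * (1 + y ^ 2) - c * k * y)) ^ 2).
  { assert (E : (c * (s * (1 + y ^ 2) - c * k * y)) ^ 2 - D2 =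
      s ^ 2 * ((1 + y ^ 2) * (c ^ 2 + s ^ 2 * y ^ 2 - 2 * c * s * k * y)
               + k ^ 2 * (c ^ 2 * y ^ 2 - 1))).
    { unfold D2, z0. replace (s ^ 2) with (c ^ 2 - 1) by lra.
      assert (E : s * s = c ^ 2 - 1) by lra. ring_simplify.
      replace (s ^ 2) with (c ^ 2 - 1) by lra. ring. }
    enough (0 <= (1 + y ^ 2) * (c ^ 2 + s ^ 2 * y ^ 2 - 2 * c * s * k * y)
               + k ^ 2 * (c ^ 2 * y ^ 2 - 1)) by nra.
    assert (c ^ 2 + s ^ 2 * y ^ 2 - 2 * c * s * k * y >= k ^ 2 - y ^ 2 * (c ^ 2 + 1)) by nra.
    assert ((1 + y ^ 2) * (c ^ 2 + s ^ 2 * y ^ 2 - 2 * c * s * k * y)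
       >= (1 + y ^ 2) * (k ^ 2 - y ^ 2 * (c ^ 2 + 1))) by (generalize (pow2_ge_0 y); nra).
    assert (0 <= y ^ 2 * (1 + c ^ 2) * z ^ 2)
      by (generalize (pow2_ge_0 (y * z)) (pow2_ge_0 (c * y * z)); nra).
    assert ((1 + y ^ 2) * (k ^ 2 - y ^ 2 * (c ^ 2 + 1)) + k ^ 2 * (c ^ 2 * y ^ 2 - 1)
       = y ^ 2 * (1 + c ^ 2) * z ^ 2).
    { replace (z ^ 2) with (k ^ 2 - 1 - y ^ 2) by lra. ring. }
    lra. }
  set (D := sqrt D2).
  assert (HDp : 0 <= D) by apply sqrt_pos.
  assert (HDD : D ^ 2 = D2) by (unfold D; rewrite pow2_sqrt; auto).
  assert (HDb : D <= c * (s * (1 + y ^ 2) - c * k * y)).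
  { apply Rsqr_incr_0_var; unfold Rsqr; nra. }
  assert (Hz0p : 1 <= z0) by lra.
  (* If [D = 0], the first point is the centre and [(w0, w1, w2)] is [(1, 0, 0)]; then [m = 0]
     works. *)
  destruct HDp as [HDp | HD0].
  2: {
    assert (z ^ 2 * z0 ^ 2 = 0) by (generalize (pow2_ge_0 (z * z0)); nra).
    assert (z ^ 2 = 0) by nra.
    assert (k ^ 2 * u ^ 2 = 0) by nra.
    assert (u ^ 2 = 0) by nra.
    assert (z0 = 1) by nra.
    assert (w0 = 1) by lra.
    assert (w1 = 0) by nra. assert (w2 = 0) by nra. assert (z = 0) by nra.
    exists 0; split; [rewrite Rabs_R0; lra |].
    subst w0 w1 w2 z.
    assert (Eu : u = 0) by nra. unfold u in Eu. unfold z0 in *.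
    assert (k * (c ^ 2 - s ^ 2) = c * (c * k - s * y) - s * (s * k - c * y)) by ring.
    assert (k = c) by nra.
    subst k; nra. }
  assert (HzD1 : Rabs z * z0 <= c * D).
  { apply Rsqr_incr_0_var; [unfold Rsqr | nra].
    replace (Rabs z * z0 * (Rabs z * z0)) with (z ^ 2 * z0 ^ 2) by (rewrite Hz2; ring).
    replace (c * D * (c * D)) with (c ^ 2 * D ^ 2) by ring. rewrite HDD; exact HzD. }
  set (h := y / c).
  assert (Hh : c * h = y) by (unfold h; field; lra).
  assert (Hhp : 0 <= h) by (unfold h; apply Rdiv_le_0_compat; lra).
  (* With [m = - (c * lam) / s] the left side is [c] times a linear form in [(w0, w1, w2)]. This
     [lam] minimises the Cauchy-Schwarz bound of that form at [w0 = z0]. *)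
  set (lam := - (z / k) * (1 + h * z0 / D)).
  assert (Hlam : k * D * lam = - z * (D + h * z0)) by (unfold lam; field; lra).
  assert (Hlb : c * Rabs lam <= s).
  { apply Rmult_le_reg_l with (k * D); [nra |].
    replace (k * D * (c * Rabs lam)) with (c * Rabs (k * D * lam)).
    2: { rewrite Rabs_mult, (Rabs_pos_eq (k * D)) by nra; ring. }
    rewrite Hlam, Rabs_mult, Rabs_Ropp, (Rabs_pos_eq (D + h * z0)) by nra.
    assert (Rabs z * z0 * y <= c * D * y) by nra.
    assert (c * Rabs z * D <= u * D) by nra. unfold u in *.
    replace (c * (Rabs z * (D + h * z0))) with (c * Rabs z * D + Rabs z * z0 * (c * h)) by ring.
    rewrite Hh. nra. }
  exists (- (c * lam) / s); split.
  { unfold Rdiv; rewrite Rabs_mult, Rabs_Ropp, Rabs_mult, (Rabs_pos_eq c),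
      (Rabs_pos_eq (/ s)) by (try lra; left; apply Rinv_0_lt_compat; lra).
    apply Rmult_le_reg_r with s; [lra |].
    rewrite Rmult_assoc, Rinv_l; lra. }
  replace (- (c * lam) / s * (s * (k * w2 - z * w0)))
    with (- (c * lam) * (k * w2 - z * w0)) by (field; lra).
  enough (HH : (k + lam * z) * w0 + (- (z + lam * k) * w2 + h * w1) <= c).
  { rewrite <- Hh. nra. }
  set (Nz := sqrt (z0 ^ 2 - 1)). set (Nw := sqrt (w0 ^ 2 - 1)).
  assert (HNz : 0 <= Nz) by apply sqrt_pos.
  assert (HNw : 0 <= Nw) by apply sqrt_pos.
  assert (HNz2 : Nz ^ 2 = z0 ^ 2 - 1) by (apply pow2_sqrt; nra).
  assert (HNw2 : Nw ^ 2 = w0 ^ 2 - 1) by (apply pow2_sqrt; nra).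
  assert (HN : Nw <= Nz)
    by (apply sqrt_le_1_alt, Rplus_le_compat_r, pow_incr; lra).
  assert (HP : - (z + lam * k) * w2 + h * w1 <= h * k * Nz / D * Nw).
  { apply cauchy2; auto.
    - apply Rdiv_le_0_compat; [| lra].
      apply Rmult_le_pos; [apply Rmult_le_pos |]; lra.
    - replace (- (z + lam * k)) with (z * h * z0 / D) by (unfold lam; field; lra).
      replace ((h * k * Nz / D) ^ 2) with (h ^ 2 * k ^ 2 * Nz ^ 2 / D ^ 2) by (field; lra).
      rewrite HNz2.
      replace ((z * h * z0 / D) ^ 2 + h ^ 2)
        with (h ^ 2 * (z ^ 2 * z0 ^ 2 + D ^ 2) / D ^ 2) by (field; lra).
      rewrite HDD at 1. rewrite HD2. rewrite Hz0.  f_equal. ring.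
    - rewrite HNw2. lra. }
  assert (Hkl : 0 <= k + lam * z).
  { assert (Rabs z <= k) by (apply Rsqr_incr_0_var; unfold Rsqr; nra).
    assert (Hl1 : Rabs lam <= 1) by (apply Rmult_le_reg_l with c; nra).
    assert (Hlz : Rabs (lam * z) <= k).
    { rewrite Rabs_mult, <- (Rmult_1_l k).
      apply Rmult_le_compat; auto using Rabs_pos. }
    apply Rabs_le_between in Hlz; lra. }
  assert (HPp : 0 <= h * k * Nz / D).
  { apply Rdiv_le_0_compat; [| lra].
      apply Rmult_le_pos; [apply Rmult_le_pos |]; lra. }
  (* Both coefficients are nonnegative, so the bound increases with [w0] and the worst case is
     [w0 = z0]. *)
  assert ((k + lam * z) * w0 + h * k * Nz / D * Nw
          <= (k + lam * z) * z0 + h * k * Nz / D * Nz) by nra.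
  enough ((k + lam * z) * z0 + h * k * Nz / D * Nz <= c) by lra.
  apply Rmult_le_reg_l with k; [lra |].
  replace (k * ((k + lam * z) * z0 + h * k * Nz / D * Nz)) with
    ((k ^ 2 - z ^ 2) * z0 + h / D * (k ^ 2 * Nz ^ 2 - z ^ 2 * z0 ^ 2))
    by (unfold lam; field; lra).
  rewrite HNz2, Hz0, <- HD2, <- HDD.
  replace (h / D * D ^ 2) with (h * D) by (field; lra).
  apply Rmult_le_reg_l with c; [lra|].
  rewrite Rmult_plus_distr_l, <- (Rmult_assoc c h), Hh.
  replace (k ^ 2 - z ^ 2) with (1 + y ^ 2) by lra.
  (* Replacing [D] by its upper bound from [HDb] turns the left side into exactly [c ^ 2 * k]. *)
  unfold z0; nra.
Qed.

(** Here the first point [(k, e, z)] lies beyond the side, at a distance whose sinh is [e]. For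
    [e = 0] the chosen [m] cancels the [w2] term and leaves [c * w0 / k <= c ^ 2]; the remaining
    terms are an error linear in [e]. *)
Lemma key_outer c s k e z w0 w1 w2 :
  0 < s -> 0 < c -> c ^ 2 = 1 + s ^ 2 -> 0 < k -> k ^ 2 = 1 + e ^ 2 + z ^ 2 ->
  0 <= e <= 1 -> c * Rabs z <= s * k + c * e ->
  1 <= w0 -> w0 ^ 2 = 1 + w1 ^ 2 + w2 ^ 2 -> w0 <= c * k + s * e ->
  exists m, Rabs m <= 1 /\
    c * k * w0 - c * z * w2 - e * w1 + m * (s * (k * w2 - z * w0))
    <= c ^ 2 + e * (3 * c ^ 2 + (2 * c + 1) * w0).
Proof.
  intros Hs Hc Hcs Hk Hz He Hsec Hw0 Hw Hwz.
  assert (Ha := Rabs_pos z).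
  assert (Hz2 : z ^ 2 = Rabs z ^ 2) by (rewrite pow2_abs; ring).
  assert (Hsc : s <= c) by nra.
  assert (Hk1 : 1 <= k) by nra.
  assert (Hzk : Rabs z <= k) by (apply Rsqr_incr_0_var; unfold Rsqr; nra).
  assert (Hw2 : Rabs w2 <= w0)
    by (apply Rsqr_incr_0_var; [rewrite <- Rsqr_abs |]; unfold Rsqr; nra).
  assert (Hw1 : Rabs w1 <= w0)
    by (apply Rsqr_incr_0_var; [rewrite <- Rsqr_abs |]; unfold Rsqr; nra).
  set (q := s * k + c * e) in *.
  assert (Hq : 0 < q) by (unfold q; nra).
  exists (c * z / q); split.
  { unfold Rdiv; rewrite !Rabs_mult, (Rabs_pos_eq c), (Rabs_pos_eq (/ q))
      by (try (left; apply Rinv_0_lt_compat); lra).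
    apply Rmult_le_reg_r with q; [lra |].
    rewrite Rmult_assoc, Rinv_l; lra. }
  assert (E : c * k * w0 - c * z * w2 - e * w1 + c * z / q * (s * (k * w2 - z * w0))
    = c * ((k ^ 2 - z ^ 2) / k) * w0 + c * e * (c * z ^ 2 / (k * q)) * w0
      - c * e * (c * z / q) * w2 - e * w1) by (unfold q; field; unfold q in Hq; lra).
  rewrite E; clear E.
  assert (B0 : c * Rabs z / q <= 1).
  { apply Rmult_le_reg_r with q; [lra |].
    unfold Rdiv; rewrite Rmult_assoc, Rinv_l; lra. }
  assert (B1 : c * z ^ 2 / (k * q) <= 1).
  { replace (c * z ^ 2 / (k * q)) with (Rabs z / k * (c * Rabs z / q))
      by (rewrite Hz2; field; lra).
    rewrite <- (Rmult_1_r 1); apply Rmult_le_compat; auto.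
    - apply Rdiv_le_0_compat; lra.
    - apply Rdiv_le_0_compat; [apply Rmult_le_pos |]; lra.
    - apply Rmult_le_reg_r with k; [lra |].
      unfold Rdiv; rewrite Rmult_assoc, Rinv_l; lra. }
  assert (B2 : - (c * z / q * w2) <= w0).
  { apply Rle_trans with (Rabs (- (c * z / q * w2))); [apply Rle_abs |].
    rewrite Rabs_Ropp, Rabs_mult, <- (Rmult_1_l w0).
    apply Rmult_le_compat; auto using Rabs_pos.
    unfold Rdiv; rewrite !Rabs_mult, (Rabs_pos_eq c), (Rabs_pos_eq (/ q))
      by (try (left; apply Rinv_0_lt_compat); lra).
    exact B0. }
  assert (B3 : - w1 <= w0) by (apply Rabs_le_between in Hw1; lra).
  assert (B4 : (k ^ 2 - z ^ 2) / k * w0 <= (1 + e ^ 2) * (c + s * e)).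
  { replace (k ^ 2 - z ^ 2) with (1 + e ^ 2) by lra.
    unfold Rdiv; rewrite Rmult_assoc; apply Rmult_le_compat_l; [nra |].
    apply Rmult_le_reg_l with k; [lra |].
    rewrite <- Rmult_assoc, Rinv_r by lra.
    assert (s * e * 1 <= s * e * k) by (apply Rmult_le_compat_l; nra). lra. }
  assert (B5 : c * ((k ^ 2 - z ^ 2) / k) * w0 <= c ^ 2 + e * (3 * c ^ 2)).
  { rewrite Rmult_assoc.
    apply Rle_trans with (c * ((1 + e ^ 2) * (c + s * e)));
      [apply Rmult_le_compat_l; lra |].
    assert (e ^ 2 <= e) by nra.
    assert ((1 + e ^ 2) * (s * e) <= 2 * (c * e))
      by (apply Rmult_le_compat; [nra | nra | lra | apply Rmult_le_compat_r; lra]).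
    replace (c * ((1 + e ^ 2) * (c + s * e)))
      with (c ^ 2 + c ^ 2 * e ^ 2 + c * ((1 + e ^ 2) * (s * e))) by ring.
    assert (c ^ 2 * e ^ 2 <= c ^ 2 * e) by (apply Rmult_le_compat_l; nra).
    assert (c * ((1 + e ^ 2) * (s * e)) <= c * (2 * (c * e)))
      by (apply Rmult_le_compat_l; lra).
    lra. }
  assert (B6 : c * e * (c * z ^ 2 / (k * q)) * w0 <= e * (c * w0)).
  { replace (e * (c * w0)) with (c * e * 1 * w0) by ring.
    apply Rmult_le_compat_r; [lra |]. apply Rmult_le_compat_l; [nra | exact B1]. }
  assert (B7 : - (c * e * (c * z / q) * w2) <= e * (c * w0)).
  { replace (- (c * e * (c * z / q) * w2)) with (e * (c * - (c * z / q * w2))) by ring.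
    apply Rmult_le_compat_l; [lra |]. apply Rmult_le_compat_l; lra. }
  assert (B8 : - (e * w1) <= e * w0) by nra.
  lra.
Qed.

Lemma key_inequality c s k y z e w0 w1 w2 :
  0 < s -> 0 < c -> c ^ 2 = 1 + s ^ 2 -> 0 < k -> k ^ 2 = 1 + y ^ 2 + z ^ 2 ->
  0 <= e <= 1 -> - e <= y -> c * Rabs z <= s * k - c * y ->
  1 <= w0 -> w0 ^ 2 = 1 + w1 ^ 2 + w2 ^ 2 -> w0 <= c * k - s * y ->
  let T := c ^ 2 + e * (3 * c ^ 2 + (2 * c + 1) * w0) in
  c * k * w0 - c * z * w2 + y * w1 + s * (k * w2 - z * w0) <= T \/
  c * k * w0 - c * z * w2 + y * w1 - s * (k * w2 - z * w0) <= T.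
Proof.
  intros Hs Hc Hcs Hk Hz He Hy Hsec Hw0 Hw Hwz T.
  destruct (Rle_dec 0 y) as [Hp | Hn].
  - destruct (key_inner c s k y z w0 w1 w2) as (m & Hm & H); auto.
    apply (convex_min_le m); auto.
    assert (0 <= e * (3 * c ^ 2 + (2 * c + 1) * w0)) by (apply Rmult_le_pos; nra).
    unfold T; lra.
  - destruct (key_outer c s k (- y) z w0 w1 w2) as (m & Hm & H); auto; try lra.
    apply (convex_min_le m); auto.
    assert (- y * (3 * c ^ 2 + (2 * c + 1) * w0) <= e * (3 * c ^ 2 + (2 * c + 1) * w0))
      by (apply Rmult_le_compat_r; nra).
    unfold T; lra.
Qed.

(** * Isometries of the hyperboloid *)

(* [nsatz] does not interpret [pow]. *)
Ltac poly := unfold Rsqr in *; cbn [pow] in *; rewrite ?Rmult_1_r in *; nsatz.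

Record vec := Vec { v0 : R; v1 : R; v2 : R }.

(** The Minkowski form. Between points of [hyp], [- form x y] is cosh of the hyperbolic distance;
    see [cosh_hdist]. *)
Definition form (x y : vec) : R := - (v0 x * v0 y) + v1 x * v1 y + v2 x * v2 y.
Definition hyp (x : vec) : Prop := form x x = - 1 /\ 0 < v0 x.
(** Preserving the form leaves open on which sheet an image lies; [hyp_preserved] settles this from
    the image of [o]. *)
Definition isometry (f : vec -> vec) : Prop := forall x y, form (f x) (f y) = form x y.

Definition rot (t : R) (x : vec) : vec :=
  Vec (v0 x) (cos t * v1 x - sin t * v2 x) (sin t * v1 x + cos t * v2 x).

Lemma vec_eq x y : v0 x = v0 y -> v1 x = v1 y -> v2 x = v2 y -> x = y.
Proof. destruct x, y; simpl; now intros -> -> ->. Qed.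

Lemma form_sym x y : form x y = form y x.
Proof. unfold form; ring. Qed.

Lemma rot_rot a b x : rot a (rot b x) = rot (a + b) x.
Proof. apply vec_eq; simpl; rewrite ?cos_plus, ?sin_plus; ring. Qed.

Lemma rot_0 x : rot 0 x = x.
Proof. apply vec_eq; simpl; rewrite ?cos_0, ?sin_0; ring. Qed.

Lemma rot_isometry t : isometry (rot t).
Proof.
  intros x y; unfold form; simpl.
  assert (E := sin2_cos2 t); unfold Rsqr in E; poly.
Qed.

Lemma rot_2PI (k : Z) x : rot (2 * PI * IZR k) x = x.
Proof.
  assert (P : forall n : nat, rot (2 * PI * INR n) x = x).
  { intros n; induction n as [| n IH]; [rewrite Rmult_0_r; apply rot_0 |].
    rewrite S_INR, Rmult_plus_distr_l, Rplus_comm, Rmult_1_r, <- rot_rot, IH.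
    apply vec_eq; simpl; rewrite ?cos_2PI, ?sin_2PI; ring. }
  destruct (Z.le_ge_cases 0 k) as [H | H].
  - rewrite <- (Z2Nat.id k H), <- INR_IZR_INZ; apply P.
  - rewrite <- (P (Z.to_nat (- k))) at 1; rewrite rot_rot, INR_IZR_INZ, Z2Nat.id by lia.
    rewrite opp_IZR; replace (_ + _) with 0 by ring; apply rot_0.
Qed.

(** * Constants of the polygon, its side translations and its rotations *)

Definition ang (g : nat) : R := PI / (4 * INR g).
(** [ch g] and [sh g] are cosh and sinh of [side g / 2], which is both half the side length and the
    inradius: the triangle of centre, vertex and side midpoint has two angles [ang g]. *)
Definition ch (g : nat) : R := cot (ang g).
Definition sh (g : nat) : R := sqrt (ch g ^ 2 - 1).

Lemma ch_gt1 g : (1 < g)%nat -> 1 < ch g.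
Proof. apply cot_gt1. Qed.

Lemma ch_sh g : (1 < g)%nat -> ch g ^ 2 = 1 + sh g ^ 2.
Proof.
  intros Hg; unfold sh; rewrite pow2_sqrt; [ring |].
  generalize (ch_gt1 g Hg); nra.
Qed.

Lemma sh_pos g : (1 < g)%nat -> 0 < sh g.
Proof. intros Hg; apply sqrt_lt_R0; generalize (ch_gt1 g Hg); nra. Qed.

Lemma ang_bounds g : (1 < g)%nat -> 0 < ang g < PI / 4.
Proof.
  intros Hg; assert (H2 : 2 <= INR g) by (apply (le_INR 2); lia).
  assert (HP := PI_RGT_0); unfold ang; split; [apply Rdiv_lt_0_compat; lra |].
  apply Rmult_lt_compat_l; [lra |]; apply Rinv_lt_contravar; nra.
Qed.

Lemma sin_ang_pos g : (1 < g)%nat -> 0 < sin (ang g).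
Proof. intros Hg; destruct (ang_bounds g Hg); apply sin_gt_0; lra. Qed.

Lemma cos_ang g : (1 < g)%nat -> cos (ang g) = ch g * sin (ang g).
Proof. intros Hg; unfold ch, cot; field; generalize (sin_ang_pos g Hg); lra. Qed.

Lemma sin_ang_sq g : (1 < g)%nat -> sin (ang g) ^ 2 * (1 + ch g ^ 2) = 1.
Proof.
  intros Hg; assert (E := sin2_cos2 (ang g)); rewrite (cos_ang g Hg) in E.
  unfold Rsqr in E; lra.
Qed.

Lemma ang_PI g (k : Z) : (1 < g)%nat -> 2 * ang g * IZR (2 * Z.of_nat g * k) = PI * IZR k.
Proof.
  intros Hg; assert (H2 : 2 <= INR g) by (apply (le_INR 2); lia).
  rewrite !mult_IZR, <- INR_IZR_INZ; unfold ang; field; lra.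
Qed.

(** One step is the central angle of a side, and [4g] steps make a full turn. *)
Definition rotz (g : nat) (k : Z) : vec -> vec := rot (2 * ang g * IZR k).

Lemma rotz_rotz g k l x : rotz g k (rotz g l x) = rotz g (k + l) x.
Proof. unfold rotz; rewrite rot_rot, plus_IZR; f_equal; ring. Qed.

Lemma rotz_0 g x : rotz g 0 x = x.
Proof. unfold rotz; rewrite Rmult_0_r; apply rot_0. Qed.

Lemma rotz_period g k l x : (1 < g)%nat -> rotz g (k + 4 * Z.of_nat g * l) x = rotz g k x.
Proof.
  intros Hg; rewrite <- rotz_rotz; f_equal; unfold rotz.
  replace (4 * Z.of_nat g * l)%Z with (2 * Z.of_nat g * (2 * l))%Z by ring.
  rewrite ang_PI, mult_IZR, <- Rmult_assoc, (Rmult_comm PI) by assumption; apply rot_2PI.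
Qed.

Lemma rotz_isometry g k : isometry (rotz g k).
Proof. apply rot_isometry. Qed.

(* The action of [t_mx g 0] on the hyperboloid. *)
Definition boost (g : nat) (x : vec) : vec :=
  let a := ch g ^ 2 + sh g ^ 2 in let b := 2 * ch g * sh g in
  Vec (a * v0 x + b * v1 x) (b * v0 x + a * v1 x) (v2 x).

Definition trans (g : nat) (k : Z) (x : vec) : vec :=
  rotz g k (boost g (rotz g (- k) x)).

Lemma boost_isometry g : (1 < g)%nat -> isometry (boost g).
Proof.
  intros Hg x y; unfold form; simpl; assert (E := ch_sh g Hg).
  poly.
Qed.

Lemma rotz_half g x : (1 < g)%nat ->
  rotz g (2 * Z.of_nat g) x = Vec (v0 x) (- v1 x) (- v2 x).
Proof.
  intros Hg; unfold rotz.
  replace (2 * Z.of_nat g)%Z with (2 * Z.of_nat g * 1)%Z by ring.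
  rewrite ang_PI, Rmult_1_r by assumption.
  apply vec_eq; simpl; rewrite ?cos_PI, ?sin_PI; ring.
Qed.

Lemma trans_isometry g k : (1 < g)%nat -> isometry (trans g k).
Proof.
  intros Hg x y; unfold trans; rewrite rotz_isometry, boost_isometry by assumption.
  apply rotz_isometry.
Qed.

Lemma trans_rotz g k l x : trans g k (rotz g l x) = rotz g l (trans g (k - l) x).
Proof.
  unfold trans; rewrite !rotz_rotz; do 3 f_equal; ring.
Qed.

(** Shifting the index by [2g] reverses the direction of translation. Words with integer letters
    therefore already contain all inverses. *)
Lemma trans_inv g k x : (1 < g)%nat -> trans g (k + 2 * Z.of_nat g) (trans g k x) = x.
Proof.
  intros Hg; unfold trans at 1 2; rewrite rotz_rotz, <- rotz_rotz.
  replace (- (k + 2 * Z.of_nat g) + k)%Z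
    with (2 * Z.of_nat g + 4 * Z.of_nat g * (- 1))%Z by ring.
  rewrite rotz_period, !rotz_half by assumption.
  replace (rotz g k _) with (rotz g k (rotz g (- k) x)).
  - rewrite rotz_rotz, Z.add_opp_diag_r; apply rotz_0.
  - f_equal; assert (E := ch_sh g Hg).
    apply vec_eq; simpl; generalize (rotz g (- k) x); intros y.
    all: poly.
Qed.

Definition word_act (g : nat) (w : list Z) (x : vec) : vec := fold_right (trans g) x w.

Lemma word_act_app g u w x : word_act g (u ++ w) x = word_act g u (word_act g w x).
Proof. apply fold_right_app. Qed.

Lemma word_act_isometry g w : (1 < g)%nat -> isometry (word_act g w).
Proof.
  intros Hg x y; induction w as [| k w IH]; simpl; auto.
  rewrite trans_isometry; auto.
Qed.

Lemma trans_inv_l g k x : (1 < g)%nat -> trans g k (trans g (k + 2 * Z.of_nat g) x) = x.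
Proof.
  intros Hg; rewrite <- (trans_inv g (k + 2 * Z.of_nat g) x Hg) at 2.
  unfold trans at 1 3.
  replace (k + 2 * Z.of_nat g + 2 * Z.of_nat g)%Z
    with (k + 4 * Z.of_nat g * 1)%Z by ring.
  replace (- (k + 4 * Z.of_nat g * 1))%Z with (- k + 4 * Z.of_nat g * (-1))%Z by ring.
  now rewrite !rotz_period.
Qed.

Lemma word_act_inv g w : (1 < g)%nat -> exists w',
  forall x, word_act g w' (word_act g w x) = x /\ word_act g w (word_act g w' x) = x.
Proof.
  intros Hg; induction w as [| k w [w' IH]]; [now exists nil |].
  exists (w' ++ (k + 2 * Z.of_nat g)%Z :: nil); intros x; simpl.
  rewrite !word_act_app; simpl; rewrite trans_inv by assumption; split; [apply IH |].
  rewrite (proj2 (IH _)); apply trans_inv_l, Hg.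
Qed.

(* [o] is the centre of the polygon and [vert g] its vertex at angle [PI/4g];
   [swap g] is the reflection exchanging the two. *)
Definition o : vec := Vec 1 0 0.
Definition vert (g : nat) : vec := Vec (ch g ^ 2) (ch g * sh g) (sh g).
Definition swap (g : nat) (x : vec) : vec :=
  let c := ch g in let s := sh g in
  Vec (c ^ 2 * v0 x - c * s * v1 x - s * v2 x)
      (c * s * v0 x - s ^ 2 * v1 x - c * v2 x)
      (s * v0 x - c * v1 x).

Lemma swap_swap g x : (1 < g)%nat -> swap g (swap g x) = x.
Proof.
  intros Hg; assert (E := ch_sh g Hg); apply vec_eq; simpl; poly.
Qed.

Lemma swap_isometry g : (1 < g)%nat -> isometry (swap g).
Proof. intros Hg x y; assert (E := ch_sh g Hg); unfold form; simpl; poly. Qed.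

Lemma swap_o g : swap g o = vert g.
Proof. apply vec_eq; simpl; ring. Qed.

(* The rotation about [vert g] by [k] steps of [2 * ang g], as [swap g] reverses
   orientation. *)
Definition rotv (g : nat) (k : Z) (x : vec) : vec := swap g (rotz g (- k) (swap g x)).

Lemma cos_2ang g : (1 < g)%nat -> (1 + ch g ^ 2) * cos (2 * ang g) = ch g ^ 2 - 1.
Proof.
  intros Hg; rewrite cos_2a_cos, (cos_ang g Hg).
  assert (E := sin_ang_sq g Hg); poly.
Qed.

Lemma sin_2ang g : (1 < g)%nat -> (1 + ch g ^ 2) * sin (2 * ang g) = 2 * ch g.
Proof.
  intros Hg; rewrite sin_2a, (cos_ang g Hg).
  assert (E := sin_ang_sq g Hg); poly.
Qed.

(** The interior angle is also one step, so turning the polygon about [vert g] by one step carries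
    it to its neighbour across a side. That neighbour is a translate of the polygon, and what
    remains is a rotation about the centre. *)
Lemma rotv_1 g x : (1 < g)%nat ->
  rotv g 1 x = trans g 0 (rotz g (2 * Z.of_nat g + -1) x).
Proof.
  intros Hg; unfold trans; rewrite rotz_0, rotz_rotz.
  replace (- 0 + (2 * Z.of_nat g + -1))%Z with (2 * Z.of_nat g + -1)%Z by ring.
  rewrite <- rotz_rotz, rotz_half by assumption.
  unfold rotv, rotz; change (- (1))%Z with (-1)%Z.
  replace (2 * ang g * -1) with (- (2 * ang g)) by ring.
  assert (E := ch_sh g Hg); assert (E1 := cos_2ang g Hg); assert (E2 := sin_2ang g Hg).
  assert (H : 1 + ch g ^ 2 <> 0) by (generalize (pow2_ge_0 (ch g)); lra).
  clear Hg; apply vec_eq; simpl; rewrite ?cos_neg, ?sin_neg;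
    revert E E1 E2 H; generalize (cos (2 * ang g)) (sin (2 * ang g)) (ch g) (sh g);
    intros C S c s E E1 E2 H; apply Rmult_eq_reg_l with (1 + c ^ 2); auto; poly.
Qed.

(** [trans g 0] after the half-turn about the centre is the half-turn about the midpoint of the
    side. Composed with the half-turn about the vertex it gives the translation along that side. *)
Lemma swap_boost_swap g x : (1 < g)%nat ->
  swap g (trans g 0 (swap g x)) =
  trans g 0 (rotz g (2 * Z.of_nat g) (rotv g (2 * Z.of_nat g) x)).
Proof.
  intros Hg; unfold rotv, trans; rewrite !rotz_0, rotz_half by assumption.
  replace (- (2 * Z.of_nat g))%Z with (2 * Z.of_nat g + 4 * Z.of_nat g * (-1))%Z by ring.
  rewrite rotz_period, rotz_half by assumption.
  assert (E := ch_sh g Hg); apply vec_eq; simpl; poly.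
Qed.

(** * Cosets of the group under rotations about the centre *)

(* The rotations about the centre normalise the group, so these sets multiply as cosets. *)
Definition in_coset (g : nat) (l : Z) (f : vec -> vec) : Prop :=
  exists w, forall x, f x = rotz g l (word_act g w x).

Lemma word_act_rotz g w l : exists w', forall x,
  word_act g w (rotz g l x) = rotz g l (word_act g w' x).
Proof.
  induction w as [| k w [w' IH]]; [now exists nil |].
  exists ((k - l)%Z :: w'); intros x; simpl; rewrite IH; apply trans_rotz.
Qed.

Lemma in_coset_comp g l m f h :
  in_coset g l f -> in_coset g m h -> in_coset g (l + m) (fun x => f (h x)).
Proof.
  intros [u Hu] [w Hw]; destruct (word_act_rotz g u m) as [u' Hu'].
  exists (u' ++ w); intros x; rewrite Hu, Hw, Hu', rotz_rotz, word_act_app; reflexivity.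
Qed.

Lemma in_coset_mod g l q m f : (1 < g)%nat ->
  m = (l + 4 * Z.of_nat g * q)%Z -> in_coset g l f -> in_coset g m f.
Proof.
  intros Hg -> [w H]; exists w; intros x; now rewrite rotz_period.
Qed.

Lemma in_coset_ext g l f h :
  (forall x, f x = h x) -> in_coset g l h -> in_coset g l f.
Proof. intros E [w H]; exists w; intros x; now rewrite E. Qed.

Lemma in_coset_rotz g l : in_coset g l (rotz g l).
Proof. now exists nil. Qed.

Lemma in_coset_trans g k : in_coset g 0 (trans g k).
Proof. exists (k :: nil); intros x; now rewrite rotz_0. Qed.

Lemma rotv_rotv g k l x : (1 < g)%nat -> rotv g k (rotv g l x) = rotv g (k + l) x.
Proof.
  intros Hg; unfold rotv; rewrite swap_swap, rotz_rotz by assumption.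
  do 2 f_equal; ring.
Qed.

Lemma rotv_0 g x : (1 < g)%nat -> rotv g 0 x = x.
Proof. intros Hg; unfold rotv; simpl; rewrite rotz_0; now apply swap_swap. Qed.

Lemma in_coset_rotv g m : (1 < g)%nat ->
  in_coset g (m * (2 * Z.of_nat g - 1)) (rotv g m).
Proof.
  intros Hg.
  assert (P : forall n : nat,
    in_coset g (Z.of_nat n * (2 * Z.of_nat g - 1)) (rotv g (Z.of_nat n))).
  { intros n; induction n as [| n IH].
    - exists nil; intros x; simpl; rewrite rotz_0; now apply rotv_0.
    - apply (in_coset_ext _ _ _ (fun x => rotv g 1 (rotv g (Z.of_nat n) x))).
      + intros x; rewrite rotv_rotv by assumption; f_equal; lia.
      + replace (Z.of_nat (S n) * (2 * Z.of_nat g - 1))%Z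
          with (0 + (2 * Z.of_nat g + -1) + Z.of_nat n * (2 * Z.of_nat g - 1))%Z by lia.
        apply in_coset_comp; auto.
        apply (in_coset_ext _ _ _ _ (fun x => rotv_1 g x Hg)).
        apply in_coset_comp; [apply in_coset_trans | apply in_coset_rotz]. }
  (* Negative [m] are reached by reducing modulo a full turn. *)
  set (N := (4 * Z.of_nat g)%Z).
  assert (HN : (0 < N)%Z) by lia.
  assert (Hm := Z.mod_pos_bound m N HN); assert (Em := Z.div_mod m N ltac:(lia)).
  apply (in_coset_mod g ((m mod N) * (2 * Z.of_nat g - 1)) (m / N * (2 * Z.of_nat g - 1)));
    auto.
  { fold N; rewrite Em at 1; ring. }
  rewrite <- (Z2Nat.id (m mod N)) by lia.
  apply (in_coset_ext _ _ _ (rotv g (Z.of_nat (Z.to_nat (m mod N))))); auto.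
  intros x; unfold rotv; f_equal.
  rewrite Z2Nat.id by lia.
  replace (- m)%Z with (- (m mod N) + 4 * Z.of_nat g * (- (m / N)))%Z.
  - now apply rotz_period.
  - fold N; rewrite Em at 3; ring.
Qed.

Lemma in_coset_swap_boost g : (1 < g)%nat ->
  in_coset g 0 (fun x => swap g (trans g 0 (swap g x))).
Proof.
  intros Hg; apply (in_coset_ext _ _ _ _ (fun x => swap_boost_swap g x Hg)).
  (* The indices add up to [2g + 2g (2g - 1) = 4g * g], a whole number of full turns. *)
  apply (in_coset_mod g (0 + (2 * Z.of_nat g + 2 * Z.of_nat g * (2 * Z.of_nat g - 1)))
    (- Z.of_nat g)); auto; [ring |].
  apply in_coset_comp; [apply in_coset_trans |].
  apply in_coset_comp; [apply in_coset_rotz | apply in_coset_rotv, Hg].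
Qed.

(** Conjugating by [rotv g k] reduces to direction [0], and the indices of the two outer cosets
    cancel. *)
Lemma swap_trans_swap g k : (1 < g)%nat ->
  in_coset g 0 (fun x => swap g (trans g k (swap g x))).
Proof.
  intros Hg.
  apply (in_coset_ext _ _ _
    (fun x => rotv g (- k) (swap g (trans g 0 (swap g (rotv g k x)))))).
  - intros x; unfold rotv; rewrite !swap_swap, Z.opp_involutive by assumption.
    unfold trans; rewrite rotz_0; simpl; now rewrite rotz_0.
  - apply (in_coset_mod g (- k * (2 * Z.of_nat g - 1) + (0 + k * (2 * Z.of_nat g - 1))) 0);
      auto; [ring |].
    apply in_coset_comp; [apply in_coset_rotv, Hg |].
    apply (in_coset_comp g 0 _ (fun x => swap g (trans g 0 (swap g x))) (rotv g k));
      [| apply in_coset_rotv, Hg].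
    apply in_coset_swap_boost, Hg.
Qed.

(** Letter by letter, [swap] normalises the translation group; this is the symmetry that exchanges
    the roles of centre and vertex. *)
Lemma swap_word g w : (1 < g)%nat -> exists w', forall x,
  swap g (word_act g w (swap g x)) = word_act g w' x.
Proof.
  intros Hg; induction w as [| k w [w' IH]].
  { exists nil; intros x; simpl; now apply swap_swap. }
  destruct (swap_trans_swap g k Hg) as [u Hu].
  exists (u ++ w'); intros x; rewrite word_act_app; simpl.
  rewrite <- IH, <- (rotz_0 g (word_act g u _)), <- Hu.
  now rewrite swap_swap.
Qed.

(** * Sectors about the centre and the upper sheet *)

Lemma polar a b : exists t, exists r, 0 <= r /\ a = r * cos t /\ b = r * sin t.
Proof.
  set (r := sqrt (a ^ 2 + b ^ 2)).
  assert (Hp : 0 <= a ^ 2 + b ^ 2) by (generalize (pow2_ge_0 a) (pow2_ge_0 b); lra).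
  assert (Hr : 0 <= r) by apply sqrt_pos.
  assert (Hr2 : r ^ 2 = a ^ 2 + b ^ 2) by (apply pow2_sqrt, Hp).
  destruct Hr as [Hr | Hr].
  2: { exists 0, 0; rewrite <- Hr in Hr2.
       assert (a = 0) by nra. assert (b = 0) by nra. subst; lra. }
  assert (Hb : -1 <= a / r <= 1).
  { apply Rabs_le_between; unfold Rdiv; rewrite Rabs_mult, (Rabs_pos_eq (/ r))
      by (left; apply Rinv_0_lt_compat, Hr).
    apply Rmult_le_reg_r with r; auto; rewrite Rmult_assoc, Rinv_l by lra.
    rewrite Rmult_1_l, Rmult_1_r.
    apply Rsqr_incr_0_var; [rewrite <- Rsqr_abs |]; unfold Rsqr; nra. }
  assert (Hc := cos_acos _ Hb).
  assert (Ha : a = r * cos (acos (a / r))) by (rewrite Hc; field; lra).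
  assert (Hs : (r * sin (acos (a / r))) ^ 2 = b ^ 2).
  { rewrite Rpow_mult_distr. assert (E := sin2_cos2 (acos (a / r))). unfold Rsqr in E. nra. }
  assert (Hs' : b = r * sin (acos (a / r)) \/ b = - (r * sin (acos (a / r)))).
  { assert ((b - r * sin (acos (a / r))) * (b + r * sin (acos (a / r))) = 0) by nra.
    apply Rmult_integral in H as [H | H]; [left | right]; lra. }
  destruct Hs' as [E | E].
  - exists (acos (a / r)), r; repeat split; auto; lra.
  - exists (- acos (a / r)), r; rewrite cos_neg, sin_neg; repeat split; auto; lra.
Qed.

(** Since [ch g] is the cotangent of [ang g], the condition says that the polar angle lies in
    [[- ang g, ang g]], an interval as long as one step. *)
Lemma sector_rotz g x : (1 < g)%nat ->
  exists j, ch g * Rabs (v2 (rotz g j x)) <= v1 (rotz g j x).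
Proof.
  intros Hg; destruct (polar (v1 x) (v2 x)) as (t & r & Hr & E1 & E2).
  destruct (ang_bounds g Hg) as [Ha Ha4]; assert (HP := PI_RGT_0).
  set (a := ang g) in *.
  set (j := up (- t / (2 * a) - 1 / 2)).
  destruct (archimed (- t / (2 * a) - 1 / 2)) as [H1 H2]; fold j in H1, H2.
  exists j; unfold rotz; fold a; simpl; rewrite E1, E2.
  set (q := 2 * a * IZR j + t).
  replace (cos (2 * a * IZR j) * (r * cos t) - sin (2 * a * IZR j) * (r * sin t))
    with (r * cos q) by (unfold q; rewrite cos_plus; ring).
  replace (sin (2 * a * IZR j) * (r * cos t) + cos (2 * a * IZR j) * (r * sin t))
    with (r * sin q) by (unfold q; rewrite sin_plus; ring).
  assert (Hq : - a <= q <= a).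
  { assert (t = - (2 * a) * (- t / (2 * a))) by (field; lra).
    set (w := - t / (2 * a)) in *.
    unfold q; rewrite H; split; nra. }
  rewrite Rabs_mult, (Rabs_pos_eq r) by assumption.
  replace (ch g * (r * Rabs (sin q))) with (r * (ch g * Rabs (sin q))) by ring.
  apply Rmult_le_compat_l; auto.
  assert (Hs := sin_ang_pos g Hg); fold a in Hs.
  assert (Hc := ch_gt1 g Hg).
  assert (Hcos : ch g * sin a <= cos q).
  { unfold a; rewrite <- cos_ang by assumption; fold a.
    destruct (Rle_dec 0 q).
    - apply cos_decr_1; lra.
    - rewrite <- (cos_neg q); apply cos_decr_1; lra. }
  assert (Hsin : Rabs (sin q) <= sin a).
  { apply Rabs_le_between; split.
    - rewrite <- sin_neg; apply sin_incr_1; lra.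
    - apply sin_incr_1; lra. }
  nra.
Qed.

Lemma hyp_isometry f x : isometry f -> hyp x -> 0 < v0 (f x) -> hyp (f x).
Proof. intros Hf [H1 _] H2; split; [rewrite Hf |]; auto. Qed.

(** The reversed Cauchy-Schwarz inequality for timelike vectors. *)
Lemma form_hyp_neg x y : hyp x -> hyp y -> form x y <= - 1.
Proof.
  intros [Hx Hx0] [Hy Hy0]; unfold form in *.
  set (p := v1 x * v1 y + v2 x * v2 y).
  assert (p ^ 2 <= (v1 x ^ 2 + v2 x ^ 2) * (v1 y ^ 2 + v2 y ^ 2)).
  { unfold p; generalize (pow2_ge_0 (v1 x * v2 y - v2 x * v1 y)); nra. }
  assert (E : p ^ 2 <= (v0 x ^ 2 - 1) * (v0 y ^ 2 - 1)) by nra.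
  assert (1 <= v0 x) by nra. assert (1 <= v0 y) by nra.
  enough (p <= v0 x * v0 y - 1) by (unfold p in *; lra).
  assert ((v0 x ^ 2 - 1) * (v0 y ^ 2 - 1) <= (v0 x * v0 y - 1) ^ 2)
    by (generalize (pow2_ge_0 (v0 x - v0 y)); nra).
  apply Rsqr_incr_0_var; unfold Rsqr; nra.
Qed.

Lemma hyp_o : hyp o.
Proof. split; unfold form, o; simpl; lra. Qed.

(** If [f x] were on the lower sheet, its negative would be on the upper one and [form_hyp_neg]
    would give [form (f o) (f x)] the wrong sign. *)
Lemma hyp_preserved f x : isometry f -> 0 < v0 (f o) -> hyp x -> hyp (f x).
Proof.
  intros Hf Ho Hx; assert (Hfo : hyp (f o)) by (apply hyp_isometry; auto using hyp_o).
  assert (E := form_hyp_neg o x hyp_o Hx); rewrite <- Hf in E.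
  destruct (Rlt_dec 0 (v0 (f x))) as [H | H]; [now apply hyp_isometry |].
  exfalso; assert (Hn : form (f x) (f x) = -1) by (rewrite Hf; apply Hx).
  set (y := f x) in *.
  assert (H0 : 0 < v0 (Vec (- v0 y) (- v1 y) (- v2 y))).
  { simpl; unfold form in Hn; nra. }
  assert (Hy : hyp (Vec (- v0 y) (- v1 y) (- v2 y))).
  { split; auto; rewrite <- Hn; unfold form; simpl; ring. }
  assert (E' := form_hyp_neg _ _ Hfo Hy).
  unfold form in E, E'; simpl in E'; lra.
Qed.

Lemma hyp_rotz g k x : hyp x -> hyp (rotz g k x).
Proof. apply hyp_preserved; [apply rotz_isometry | simpl; lra]. Qed.

Lemma hyp_boost g x : (1 < g)%nat -> hyp x -> hyp (boost g x).
Proof.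
  intros Hg; apply hyp_preserved; [now apply boost_isometry |].
  simpl; generalize (ch_gt1 g Hg); nra.
Qed.

Lemma hyp_swap g x : (1 < g)%nat -> hyp x -> hyp (swap g x).
Proof.
  intros Hg; apply hyp_preserved; [now apply swap_isometry |].
  simpl; generalize (ch_gt1 g Hg); nra.
Qed.

Lemma hyp_word g w x : (1 < g)%nat -> hyp x -> hyp (word_act g w x).
Proof.
  intros Hg Hx; induction w as [| k w IH]; simpl; auto.
  apply hyp_rotz, hyp_boost, hyp_rotz; auto.
Qed.

(** * The covering radius of orbits *)

Lemma sector_close g z w e : (1 < g)%nat -> hyp z -> hyp w -> 0 <= e <= 1 ->
  ch g * Rabs (v2 z) <= v1 z -> - e <= sh g * v0 z - ch g * v1 z ->
  v0 (swap g w) <= v0 z ->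
  let T := ch g ^ 2 + e * (3 * ch g ^ 2 + (2 * ch g + 1) * v0 z) in
  - form z w <= T \/ - form z (swap g (trans g 0 (swap g w))) <= T.
Proof.
  intros Hg Hz Hw He Hsec Hy Hle T.
  assert (Hc := ch_gt1 g Hg); assert (Hs := sh_pos g Hg); assert (E := ch_sh g Hg).
  assert (Hw' := hyp_swap g w Hg Hw).
  destruct Hz as [Hz Hz0], Hw as [Hw Hw0], Hw' as [Hsw Hsw0].
  unfold form in Hz, Hw, Hsw.
  assert (H1 : 1 <= v0 (swap g w)) by nra.
  (* Both values of cosh are expressed in the frame of the midpoint of the side: [k] is the first
     coordinate of [z], and [b0], [b2] belong to [w] moved along the side so that the vertex goes to
     the midpoint. *)
  assert (Ht : - form z (swap g (trans g 0 (swap g w))) =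
    let c := ch g in let s := sh g in
    let k := c * v0 z - s * v1 z in
    let m0 := c * v0 w - s * v1 w in let b0 := v0 (swap g w) in
    let b2 := - s * m0 + c * v2 w in
    c * k * b0 - c * v2 z * b2 + (s * v0 z - c * v1 z) * (c * v1 w - s * v0 w)
     - s * (k * b2 - v2 z * b0)).
  { unfold trans; rewrite !rotz_0; unfold form; simpl.
    clear - E; revert E; generalize (ch g) (sh g) (v0 z) (v1 z) (v2 z) (v0 w) (v1 w) (v2 w).
    intros; poly. }
  assert (Hd : - form z w =
    let c := ch g in let s := sh g in
    let k := c * v0 z - s * v1 z in
    let m0 := c * v0 w - s * v1 w in let b0 := v0 (swap g w) in
    let b2 := - s * m0 + c * v2 w in
    c * k * b0 - c * v2 z * b2 + (s * v0 z - c * v1 z) * (c * v1 w - s * v0 w)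
     + s * (k * b2 - v2 z * b0)).
  { unfold form; simpl.
    clear - E; revert E; generalize (ch g) (sh g) (v0 z) (v1 z) (v2 z) (v0 w) (v1 w) (v2 w).
    intros; poly. }
  rewrite Ht, Hd; cbv zeta; clear Ht Hd.
  set (c := ch g) in *; set (s := sh g) in *.
  assert (Hsc : s < c) by nra.
  assert (Hz1 : Rabs (v1 z) <= v0 z)
    by (apply Rsqr_incr_0_var; [rewrite <- Rsqr_abs |]; unfold Rsqr; nra).
  apply Rabs_le_between in Hz1.
  assert (Hle' : e * (3 * c ^ 2 + (2 * c + 1) * v0 (swap g w))
     <= e * (3 * c ^ 2 + (2 * c + 1) * v0 z)) by (apply Rmult_le_compat_l; nra).
  destruct (key_inequality c s (c * v0 z - s * v1 z) (s * v0 z - c * v1 z) (v2 z) e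
    (v0 (swap g w)) (c * v1 w - s * v0 w) (- s * (c * v0 w - s * v1 w) + c * v2 w))
    as [H | H]; auto; try lra.
  - nra.
  - clear - E Hz; revert E Hz; generalize (v0 z) (v1 z) (v2 z) c s; intros; poly.
  - replace (s * (c * v0 z - s * v1 z) - c * (s * v0 z - c * v1 z)) with (v1 z); auto.
    clear - E; revert E; generalize (v0 z) (v1 z) (v2 z) c s; intros; poly.
  - simpl; fold c s.
    clear - E Hw; revert E Hw; generalize (v0 w) (v1 w) (v2 w) c s; intros; poly.
  - replace (c * (c * v0 z - s * v1 z) - s * (s * v0 z - c * v1 z)) with (v0 z); auto.
    clear - E; revert E; generalize (v0 z) (v1 z) (v2 z) c s; intros; poly.
  - left; unfold T; lra.
  - right; unfold T; lra.
Qed.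

Lemma orbit_close g x y e : (1 < g)%nat -> hyp x -> hyp y -> 0 <= e <= 1 ->
  (forall w, v0 x <= v0 (word_act g w x) + 2 * sh g * e) ->
  v0 (swap g y) <= v0 x ->
  exists w, - form x (word_act g w y)
    <= ch g ^ 2 + e * (3 * ch g ^ 2 + (2 * ch g + 1) * v0 x).
Proof.
  intros Hg Hx Hy He Hmin Hle.
  destruct (sector_rotz g x Hg) as [j Hj].
  assert (Hs := sh_pos g Hg); assert (E := ch_sh g Hg).
  (* As [(2g - 1) ^ 2] is [1] modulo [4g], this rotation about the vertex lies in the same coset as
     [rotz g j]. It can thus accompany the rotation of [x] into the standard sector while keeping
     the distance of [y] to the vertex. *)
  assert (Hrv : in_coset g j (rotv g (j * (2 * Z.of_nat g - 1)))).
  { apply (in_coset_mod g (j * (2 * Z.of_nat g - 1) * (2 * Z.of_nat g - 1))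
      (j * (1 - Z.of_nat g))); auto; [ring | now apply in_coset_rotv]. }
  assert (Hback : forall u, form (rotz g j x) (rotz g j u) = form x u)
    by (intros; apply rotz_isometry).
  destruct (sector_close g (rotz g j x) (rotv g (j * (2 * Z.of_nat g - 1)) y) e)
    as [H | H]; auto.
  - now apply hyp_rotz.
  - apply hyp_swap, hyp_rotz, hyp_swap; auto.
  - assert (Hm : v0 (rotz g j x)
      <= v0 (rotz g j (trans g (2 * Z.of_nat g - j) x)) + 2 * sh g * e)
      by exact (Hmin ((2 * Z.of_nat g - j)%Z :: nil)).
    rewrite <- trans_rotz in Hm.
    set (z := rotz g j x) in *.
    unfold trans in Hm.
    replace (- (2 * Z.of_nat g))%Z with (2 * Z.of_nat g + 4 * Z.of_nat g * (-1))%Z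
      in Hm by ring.
    rewrite rotz_period, !rotz_half in Hm by assumption.
    cbn [v0 v1 v2 rotz rot boost] in Hm; rewrite E in Hm.
    assert (0 <= 2 * sh g * (sh g * v0 z - ch g * v1 z + e)) by lra.
    assert (0 <= sh g * v0 z - ch g * v1 z + e); [| lra].
    apply Rmult_le_reg_l with (2 * sh g); lra.
  - unfold rotv; rewrite swap_swap by assumption; exact Hle.
  - destruct Hrv as [w Hw]; exists w; rewrite <- Hback, <- Hw; exact H.
  - assert (Hc : in_coset g (0 + j)
      (fun u => swap g (trans g 0 (swap g (rotv g (j * (2 * Z.of_nat g - 1)) u))))).
    { apply (in_coset_comp g 0 j (fun u => swap g (trans g 0 (swap g u)))); auto.
      now apply in_coset_swap_boost. }
    destruct Hc as [w Hw]; exists w; rewrite <- Hback, <- Hw; exact H.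
Qed.

(** Orbit points nearest to the centre are replaced by near-minimisers; the slack [d] is the origin
    of [e] in the distance estimate. *)
Lemma approx_min {A : Type} (a : A) (f : A -> R) d :
  (forall x, 0 <= f x) -> 0 < d -> exists x, forall y, f x <= f y + d.
Proof.
  intros Hf Hd.
  destruct (completeness (fun r => exists x, r = - f x)) as [m [Hm1 Hm2]].
  { exists 0; intros r [x ->]; generalize (Hf x); lra. }
  { now exists (- f a), a. }
  destruct (Classical_Prop.classic (exists x, m - d < - f x)) as [[x Hx] | Hn].
  - exists x; intros y; assert (- f y <= m) by (apply Hm1; now exists y); lra.
  - exfalso; assert (m <= m - d); [| lra].
    apply Hm2; intros r [x ->]; apply Rnot_lt_le; intros H; apply Hn; now exists x.
Qed.

Lemma covering_bound g x y d : (1 < g)%nat -> hyp x -> hyp y -> 0 < d ->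
  exists u w, - form (word_act g u x) (word_act g w y) <= ch g ^ 2 + d.
Proof.
  intros Hg Hx Hy Hd.
  assert (Hc := ch_gt1 g Hg); assert (Hs := sh_pos g Hg).
  assert (Hsy := hyp_swap g y Hg Hy).
  (* [M] bounds [v0] at both near-minimisers because [e <= 1]. Then [K] bounds the error factor of
     [orbit_close], and [e] is chosen with [e * K <= d]. *)
  set (M := v0 x + v0 (swap g y) + 2 * sh g).
  set (K := 3 * ch g ^ 2 + (2 * ch g + 1) * M).
  assert (HM : 0 < M) by (unfold M; destruct Hx, Hsy; lra).
  assert (HK : 0 < K) by (unfold K; nra).
  set (e := Rmin 1 (d / K)).
  assert (He : 0 < e <= 1).
  { unfold e; split; [| apply Rmin_l].
    apply Rmin_pos; [lra | now apply Rdiv_lt_0_compat]. }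
  assert (HeK : e * K <= d).
  { apply Rle_trans with (d / K * K); [| right; field; lra].
    apply Rmult_le_compat_r; [lra | apply Rmin_r]. }
  assert (Hse : 0 < 2 * sh g * e <= 2 * sh g) by nra.
  assert (Bound : forall r, r <= M -> e * (3 * ch g ^ 2 + (2 * ch g + 1) * r) <= d).
  { intros r Hr; eapply Rle_trans; [| exact HeK].
    apply Rmult_le_compat_l; [lra |]; unfold K.
    apply Rplus_le_compat_l, Rmult_le_compat_l; lra. }
  assert (Min : forall z, hyp z -> exists w, forall w',
    v0 (word_act g w z) <= v0 (word_act g w' z) + 2 * sh g * e).
  { intros z Hz; apply (approx_min (@nil Z) (fun w => v0 (word_act g w z))); [| lra].
    intros w; left; apply (hyp_word g w z Hg Hz). }
  destruct (Min x Hx) as [u Hu], (Min _ Hsy) as [w Hw].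
  assert (Bu := Hu nil); assert (Bw := Hw nil); cbn [word_act fold_right] in Bu, Bw.
  set (x' := word_act g u x) in *; set (y' := word_act g w (swap g y)) in *.
  assert (Hx' : hyp x') by now apply hyp_word.
  assert (Hy' : hyp y') by now apply hyp_word.
  assert (Vx := proj2 Hx); assert (Vy := proj2 Hsy).
  (* [v0 y'] is cosh of the distance from a point of the orbit of [y] to the vertex. If it exceeds
     [v0 x'], the two points exchange roles through [swap]. *)
  destruct (Rle_dec (v0 y') (v0 x')) as [Hle | Hle].
  - destruct (orbit_close g x' (swap g y') e) as [w1 H1]; auto; try lra.
    + now apply hyp_swap.
    + intros v; unfold x' at 2; rewrite <- word_act_app; apply Hu.
    + now rewrite swap_swap.
    + destruct (swap_word g w Hg) as [w2 Hw2].
      exists u, (w1 ++ w2); rewrite word_act_app, <- Hw2; fold y' x'.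
      eapply Rle_trans; [exact H1 |]; apply Rplus_le_compat_l, Bound; unfold M; lra.
  - destruct (orbit_close g y' (swap g x') e) as [w1 H1]; auto; try lra.
    + now apply hyp_swap.
    + intros v; unfold y' at 2; rewrite <- word_act_app; apply Hw.
    + rewrite swap_swap by assumption; lra.
    + destruct (word_act_inv g w1 Hg) as [w1' Hi].
      destruct (swap_word g (w1' ++ w) Hg) as [w2 Hw2].
      exists u, w2; rewrite <- Hw2, word_act_app; fold y' x'.
      rewrite form_sym, <- (swap_isometry g Hg), swap_swap by assumption.
      rewrite <- (word_act_isometry g w1 Hg), (proj2 (Hi _)).
      eapply Rle_trans; [exact H1 |]; apply Rplus_le_compat_l, Bound; unfold M; lra.
Qed.

(** * Reflection groups *)

Definition lin (p : R) (x : vec) (q : R) (y : vec) : vec :=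
  Vec (p * v0 x + q * v0 y) (p * v1 x + q * v1 y) (p * v2 x + q * v2 y).

Definition refl (e x : vec) : vec := lin 1 x (- 2 * form e x) e.

Lemma refl_lin e p x q y : refl e (lin p x q y) = lin p (refl e x) q (refl e y).
Proof. apply vec_eq; unfold refl, lin, form; simpl; ring. Qed.

Lemma refl_refl e x : form e e = 1 -> refl e (refl e x) = x.
Proof.
  intros He; unfold refl, form in *; destruct x as [x y z], e as [a b c]; simpl in *.
  apply vec_eq; simpl; poly.
Qed.

(* The sides of the triangle formed by the centre, a vertex and the midpoint of an
   adjacent side of the polygon. *)
Inductive mirror := Axis | Diag | Side.

Definition root (g : nat) (i : mirror) : vec :=
  match i with
  | Axis => Vec 0 0 1
  | Diag => Vec 0 (sin (ang g)) (- cos (ang g))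
  | Side => Vec (- sh g) (- ch g) 0
  end.

Lemma root_unit g i : (1 < g)%nat -> form (root g i) (root g i) = 1.
Proof.
  intros Hg; assert (E := ch_sh g Hg); assert (E' := sin2_cos2 (ang g)).
  unfold Rsqr in E'; destruct i; unfold form; simpl; lra.
Qed.

Definition act (g : nat) (w : list mirror) (x : vec) : vec :=
  fold_right (fun i => refl (root g i)) x w.

Lemma act_app g u w x : act g (u ++ w) x = act g u (act g w x).
Proof. apply fold_right_app. Qed.

Lemma act_lin g w p x q y : act g w (lin p x q y) = lin p (act g w x) q (act g w y).
Proof. induction w as [| i w IH]; simpl; auto; rewrite IH; apply refl_lin. Qed.

(* Recording the parity of the length spares the proof that the determinant is a
   sign character. *)
Definition eqw (g : nat) (u w : list mirror) : Prop :=
  (forall x, act g u x = act g w x) /\ Nat.even (length u) = Nat.even (length w).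

Lemma eqw_refl g u : eqw g u u.
Proof. now split. Qed.

Lemma eqw_sym g u w : eqw g u w -> eqw g w u.
Proof. intros [H E]; split; auto. Qed.

Lemma eqw_trans g u v w : eqw g u v -> eqw g v w -> eqw g u w.
Proof.
  intros [H E] [H' E']; split; [intros x; now rewrite H | now rewrite E].
Qed.

Lemma eqw_app g u u' w w' : eqw g u u' -> eqw g w w' -> eqw g (u ++ w) (u' ++ w').
Proof.
  intros [H E] [H' E']; split.
  - intros x; now rewrite !act_app, H', H.
  - now rewrite !length_app, !Nat.even_add, E, E'.
Qed.

Lemma eqw_cancel g i w : (1 < g)%nat -> eqw g (i :: i :: w) w.
Proof. intros Hg; split; auto; intros x; simpl; now apply refl_refl, root_unit. Qed.

Lemma eqw_cancel_mid g u i w : (1 < g)%nat -> eqw g (u ++ i :: i :: w) (u ++ w).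
Proof. intros Hg; apply eqw_app; [apply eqw_refl | now apply eqw_cancel]. Qed.

(** Built from the right so that a nonempty word ends in [j]; appending [i] to [alt i j k] gives
    [alt j i (S k)]. *)
Fixpoint alt (i j : mirror) (k : nat) : list mirror :=
  match k with O => nil | S k => alt j i k ++ j :: nil end.

Definition over (i j : mirror) : list mirror -> Prop := List.Forall (fun k => k = i \/ k = j).

Lemma alt_length i j k : length (alt i j k) = k.
Proof.
  revert i j; induction k as [| k IH]; intros i j; simpl; auto.
  rewrite length_app, IH; simpl; lia.
Qed.

Lemma over_sym i j u : over i j u -> over j i u.
Proof. apply Forall_impl; intros k [H | H]; auto. Qed.

Lemma over_alt i j k : over i j (alt i j k).
Proof.
  revert i j; induction k as [| k IH]; intros i j; simpl; [constructor |].
  apply Forall_app; split; [apply over_sym, IH | constructor; [auto | constructor]].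
Qed.

Lemma alt_split i j r m :
  exists p, over i j p /\ length p = r /\ alt i j (m + r) = p ++ alt i j m.
Proof.
  revert i j; induction m as [| m IH]; intros i j; simpl.
  - exists (alt i j r); repeat split; auto using over_alt, alt_length.
    now rewrite app_nil_r.
  - destruct (IH j i) as (p & Hp & Hl & E); exists p; repeat split; auto using over_sym.
    now rewrite E, app_assoc.
Qed.

Lemma nat_least (P : nat -> Prop) :
  (exists n, P n) -> exists n, P n /\ forall m, P m -> (n <= m)%nat.
Proof.
  intros [n Hn]; induction n as [n IH] using lt_wf_ind.
  destruct (Classical_Prop.classic (exists m, P m /\ (m < n)%nat)) as [(m & Hm & L) | H].
  - now apply (IH m).
  - exists n; split; auto; intros m Hm; apply Nat.nlt_ge; intros L; apply H; now exists m.
Qed.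

Lemma over_cases g i j u : (1 < g)%nat -> over i j u ->
  (exists k, u = alt i j k) \/ (exists k, u = alt j i (S k)) \/
  (exists u', over i j u' /\ eqw g u' u /\ (length u' < length u)%nat).
Proof.
  intros Hg; induction u as [| k u IH] using rev_ind; intros Hu; [left; now exists O |].
  apply Forall_app in Hu as [Hu Hk]; apply Forall_inv in Hk.
  assert (Cancel : forall a v, over i j v -> exists u',
    over i j u' /\ eqw g u' ((v ++ a :: nil) ++ a :: nil) /\
    (length u' < length ((v ++ a :: nil) ++ a :: nil))%nat).
  { intros a v Hv; exists v; rewrite <- app_assoc; simpl; split; [exact Hv | split].
    - apply eqw_sym; rewrite <- (app_nil_r v) at 2; now apply eqw_cancel_mid.
    - rewrite length_app; simpl; lia. }
  destruct (IH Hu) as [[n ->] | [[n ->] | (u' & Hu' & E & L)]].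
  - destruct Hk as [-> | ->]; [right; left; now exists n |].
    destruct n as [| n]; [left; now exists 1%nat |].
    right; right; apply Cancel, over_sym, over_alt.
  - destruct Hk as [-> | ->]; [| left; now exists (S (S n))].
    right; right; apply Cancel, over_alt.
  - right; right; exists (u' ++ k :: nil); split; [| split].
    + apply Forall_app; split; [exact Hu' | constructor; [auto | constructor]].
    + apply eqw_app; auto using eqw_refl.
    + rewrite !length_app; lia.
Qed.

(** [D] is the set of competing words: those of a dihedral subgroup, or all. When [D] is closed
    under appending [i], the condition forces [w] to be reduced in [D], since a shorter word
    followed by [i] would violate it. *)
Definition ascends (g : nat) (D : list mirror -> Prop) (w : list mirror) (i : mirror) : Prop :=
  forall u, D u -> eqw g u (w ++ i :: nil) -> (length w < length u)%nat.

(** A reduced word in two letters alternates, and it cannot end in [i]. If it had [m] letters or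
    more, the braid relation would rewrite its last [m] letters to end in [i], which then
    cancels. *)
Lemma dihedral_ascends g i j m u : (1 < g)%nat -> over i j u ->
  eqw g (alt i j m) (alt j i m) -> (0 < m)%nat ->
  ascends g (over i j) u i -> exists k, (k < m)%nat /\ u = alt i j k.
Proof.
  intros Hg Hu Hb Hm Ha.
  destruct (over_cases g i j u Hg Hu) as [[k ->] | [[k ->] | (u' & Hu' & E & L)]].
  - exists k; split; auto; apply Nat.nle_gt; intros Hk.
    destruct (alt_split i j (k - m) m) as (p & Hp & Hl & E).
    replace (m + (k - m))%nat with k in E by lia.
    destruct m as [| m]; [lia |].
    specialize (Ha (p ++ alt i j m)).
    rewrite length_app, !alt_length in Ha.
    enough (k < length p + m)%nat by lia; apply Ha.
    + apply Forall_app; split; [exact Hp | apply over_alt].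
    + rewrite E, <- app_assoc.
      apply eqw_app; auto using eqw_refl; apply eqw_sym.
      eapply eqw_trans; [apply eqw_app; [exact Hb | apply eqw_refl] |]; simpl.
      rewrite <- app_assoc.
      rewrite <- (app_nil_r (alt i j m)) at 2; now apply eqw_cancel_mid.
  - exfalso; assert (H := Ha (alt i j k) (over_alt _ _ _)).
    rewrite !alt_length in H; enough (S k < k)%nat by lia; apply H.
    simpl; rewrite <- app_assoc; apply eqw_sym.
    rewrite <- (app_nil_r (alt i j k)) at 2; now apply eqw_cancel_mid.
  - exfalso; assert (H := Ha (u' ++ i :: nil)); rewrite length_app in H; simpl in H.
    enough (length u < length u' + 1)%nat by lia; apply H.
    + apply Forall_app; split; [exact Hu' | constructor; [auto | constructor]].
    + apply eqw_app; auto using eqw_refl.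
Qed.

(* The term [lin _ _ 0 o] is scalar multiplication: everything is scaled by [sin t]. *)
Lemma act_alt g (t : R) i j k : (1 < g)%nat -> form (root g i) (root g j) = - cos t ->
  let S k := sin (INR k * t) in
  lin (sin t) (act g (alt i j k) (root g i)) 0 o =
  if Nat.even k then lin (S (k + 1)%nat) (root g i) (S k) (root g j)
  else lin (S (k + 1)%nat) (root g j) (S k) (root g i).
Proof.
  intros Hg Hij S.
  assert (Rec : forall k, S (k + 2)%nat = 2 * cos t * S (k + 1)%nat - S k).
  { intros n; unfold S; rewrite !plus_INR; simpl INR.
    replace ((INR n + (1 + 1)) * t) with ((INR n + 1) * t + t) by ring.
    replace (INR n * t) with ((INR n + 1) * t - t) by ring.
    rewrite sin_plus, sin_minus; ring. }
  assert (S0 : S O = 0) by (unfold S; simpl; rewrite Rmult_0_l; apply sin_0).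
  assert (S1 : S 1%nat = sin t) by (unfold S; simpl; now rewrite Rmult_1_l).
  clearbody S.
  assert (Step : forall i j, form (root g i) (root g j) = - cos t -> forall n,
    act g (alt i j (Datatypes.S (Datatypes.S n))) (root g i) =
    lin (- 1) (act g (alt i j n) (root g i)) (2 * cos t)
        (act g (alt j i (Datatypes.S n)) (root g j))).
  { clear i j Hij; intros i j Hij n.
    cbn [alt]; rewrite !act_app; cbn [act fold_right].
    replace (refl (root g j) (root g i)) with (lin 1 (root g i) (2 * cos t) (root g j))
      by (unfold refl; rewrite form_sym, Hij; f_equal; ring).
    rewrite refl_lin.
    replace (refl (root g i) (root g i)) with (lin (-1) (root g i) 0 o)
      by (unfold refl; rewrite root_unit by assumption; apply vec_eq; simpl; ring).
    rewrite !act_lin. apply vec_eq; simpl; ring. }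
  (* The recurrence for the roots, like the one for the sines, has order two, so two consecutive
     cases are carried. *)
  assert (P : forall n i j, form (root g i) (root g j) = - cos t ->
    (lin (sin t) (act g (alt i j n) (root g i)) 0 o =
     if Nat.even n then lin (S (n + 1)%nat) (root g i) (S n) (root g j)
     else lin (S (n + 1)%nat) (root g j) (S n) (root g i)) /\
    (lin (sin t) (act g (alt i j (Datatypes.S n)) (root g i)) 0 o =
     if Nat.even (Datatypes.S n)
     then lin (S (n + 2)%nat) (root g i) (S (n + 1)%nat) (root g j)
     else lin (S (n + 2)%nat) (root g j) (S (n + 1)%nat) (root g i))).
  { clear i j k Hij; induction n as [| n IH]; intros i j Hij.
    - split.
      + simpl; rewrite S0, S1; apply vec_eq; simpl; ring.
      + assert (S2 := Rec O); simpl in S2 |- *; rewrite S2, S1, S0.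
        unfold refl; rewrite form_sym, Hij; apply vec_eq; simpl; ring.
    - destruct (IH i j Hij) as [H1 H2]; split.
      + replace (Datatypes.S n + 1)%nat with (n + 2)%nat by lia.
        replace (S (Datatypes.S n)) with (S (n + 1)%nat) by (f_equal; lia).
        exact H2.
      + rewrite Step by assumption.
        destruct (IH j i ltac:(now rewrite form_sym)) as [_ H3].
        change (Nat.even (Datatypes.S (Datatypes.S n))) with (Nat.even n).
        replace (Datatypes.S n + 2)%nat with (n + 1 + 2)%nat by lia.
        replace (Datatypes.S n + 1)%nat with (n + 2)%nat by lia.
        replace (lin (sin t) _ 0 o) with
          (lin (-1) (lin (sin t) (act g (alt i j n) (root g i)) 0 o) (2 * cos t)
             (lin (sin t) (act g (alt j i (Datatypes.S n)) (root g j)) 0 o))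
          by (apply vec_eq; simpl; ring).
        rewrite H1, H3, (Rec (n + 1)%nat), Nat.even_succ, <- Nat.negb_even.
        replace (n + 1 + 1)%nat with (n + 2)%nat by lia.
        rewrite !(Rec n).
        destruct (Nat.even n); simpl; apply vec_eq; simpl; ring. }
  apply P, Hij.
Qed.

(* By duality: [x] lies in the closed convex cone spanned by the roots. *)
Definition nonneg (g : nat) (x : vec) : Prop :=
  forall f : vec -> R, (forall p x q y, f (lin p x q y) = p * f x + q * f y) ->
    (forall i, 0 <= f (root g i)) -> 0 <= f x.

(** Induction on length. If [w] ends in [j], factor it as [v ++ u] with [u] over [i], [j] and [v]
    shortest. Then [v] ascends at both letters, and [u] maps the root of [i] to a nonnegative
    combination of the two roots by [act_alt]; the induction hypothesis for [v] concludes. *)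
Lemma ascends_nonneg g (m : mirror -> mirror -> nat) : (1 < g)%nat ->
  (forall i j, i <> j -> (1 < m i j)%nat /\
     form (root g i) (root g j) = - cos (PI / INR (m i j)) /\
     forall x, act g (alt i j (m i j)) x = act g (alt j i (m i j)) x) ->
  forall w i, ascends g (fun _ => True) w i -> nonneg g (act g w (root g i)).
Proof.
  intros Hg Hm w; remember (length w) as n eqn:Hn; revert w Hn.
  induction n as [n IH] using lt_wf_ind; intros w -> i Ha.
  destruct w as [| j w _] using rev_ind; [intros f _ Hf; apply Hf |].
  assert (Hij : i <> j).
  { intros ->; assert (H := Ha w I); rewrite length_app in H; simpl in H.
    enough (length w + 1 < length w)%nat by lia; apply H.
    rewrite <- app_assoc; simpl; apply eqw_sym.
    rewrite <- (app_nil_r w) at 2; now apply eqw_cancel_mid. }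
  set (w0 := w ++ j :: nil) in *.
  assert (Hw0 : length w0 = S (length w)) by (unfold w0; rewrite length_app; simpl; lia).
  destruct (nat_least (fun l => exists v u, length v = l /\ over i j u /\
    eqw g (v ++ u) w0 /\ (length v + length u <= length w0)%nat))
    as (l & (v & u & Hl & Hu & E & L) & Hmin).
  { exists (length w), w, (j :: nil); repeat split; auto;
      [constructor; [auto | constructor] | simpl; lia]. }
  assert (Hlw : (l <= length w)%nat).
  { apply Hmin; exists w, (j :: nil); repeat split; auto;
      [constructor; [auto | constructor] | simpl; lia]. }
  assert (Hv : forall k, k = i \/ k = j -> nonneg g (act g v (root g k))).
  { intros k Hk; apply (IH (length v)); auto; [lia |].
    intros v2 _ E2; apply Nat.nle_gt; intros L2.
    (* Parity excludes equal lengths; a strictly shorter [v2] would contradict the minimality of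
       [l]. *)
    assert (L3 : (length v2 < length v)%nat).
    { enough (length v2 <> length v) by lia; intros E3.
      destruct E2 as [_ E2]; rewrite length_app, Nat.even_add, E3 in E2; simpl in E2.
      now destruct (Nat.even (length v)). }
    enough (l <= length v2)%nat by lia.
    apply Hmin; exists v2, (k :: u); split; [| split; [| split]]; simpl; auto.
    - constructor; auto.
    - eapply eqw_trans; [apply eqw_app; [exact E2 | apply eqw_refl] |].
      rewrite <- app_assoc; simpl.
      eapply eqw_trans; [now apply eqw_cancel_mid | exact E].
    - lia. }
  destruct (Hm i j Hij) as (Hm1 & Hform & Hbraid).
  destruct (dihedral_ascends g i j (m i j) u) as (k & Hk & ->); auto; try lia.
  { split; auto; now rewrite !alt_length. }
  { intros u2 _ E2; assert (H := Ha (v ++ u2) I); rewrite length_app in H.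
    enough (length w0 < length v + length u2)%nat by lia; apply H.
    eapply eqw_trans; [apply eqw_app; [apply eqw_refl | exact E2] |].
    rewrite app_assoc; apply eqw_app; auto using eqw_refl. }
  assert (EA := act_alt g (PI / INR (m i j)) i j k Hg Hform); cbv zeta in EA.
  set (t := PI / INR (m i j)) in *.
  assert (Hm2 : 2 <= INR (m i j)) by (apply (le_INR 2); lia).
  assert (HP := PI_RGT_0).
  assert (Htm : INR (m i j) * t = PI) by (unfold t; field; lra).
  assert (Ht : 0 < t) by (apply Rdiv_lt_0_compat; lra).
  assert (Hsin : forall n, (n <= m i j)%nat -> 0 <= sin (INR n * t)).
  { intros n Hn; apply le_INR in Hn; apply sin_ge_0.
    - apply Rmult_le_pos; [apply pos_INR | lra].
    - rewrite <- Htm; apply Rmult_le_compat_r; lra. }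
  assert (Hst : 0 < sin t) by (apply sin_gt_0; nra).
  intros f Hf Hpos.
  assert (Hi := Hv i (or_introl eq_refl) f Hf Hpos).
  assert (Hj := Hv j (or_intror eq_refl) f Hf Hpos).
  (* Since [k < m i j], both multiples of [t] lie in [[0, PI]], so the coefficients in [act_alt] are
     nonnegative. *)
  assert (S1 := Hsin k ltac:(lia)); assert (S2 := Hsin (k + 1)%nat ltac:(lia)).
  rewrite <- (proj1 E), act_app.
  set (y := act g (alt i j k) (root g i)) in *.
  assert (Ey : sin t * f (act g v y) = f (act g v (lin (sin t) y 0 o)))
    by (rewrite act_lin, Hf; ring).
  apply Rmult_le_reg_l with (sin t); auto; rewrite Rmult_0_r, Ey, EA.
  destruct (Nat.even k); rewrite act_lin, Hf; apply Rplus_le_le_0_compat; now apply Rmult_le_pos.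
Qed.

(** * The Coxeter relations of the triangle group (2, 4g, 4g) *)

Definition order (g : nat) (i j : mirror) : nat :=
  match i, j with Axis, Side | Side, Axis => 2 | _, _ => 2 * (2 * g) end.

Lemma act_alt_even g i j n x :
  act g (alt i j (2 * n)) x =
  Nat.iter n (fun y => refl (root g i) (refl (root g j) y)) x.
Proof.
  revert x; induction n as [| n IH]; intros x; [reflexivity |].
  replace (2 * S n)%nat with (S (S (2 * n))) by lia.
  cbn [alt]; rewrite !act_app, IH, Nat.iter_succ_r; reflexivity.
Qed.

Lemma refl_diag_axis g x : (1 < g)%nat ->
  refl (root g Diag) (refl (root g Axis) x) = rotz g 1 x.
Proof.
  intros Hg; unfold rotz; rewrite Rmult_1_r.
  apply vec_eq; unfold refl, form; simpl; rewrite ?cos_2a_cos, ?sin_2a;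
    assert (E := sin2_cos2 (ang g)); clear Hg; revert E;
    generalize (cos (ang g)) (sin (ang g)); intros; poly.
Qed.

Lemma refl_axis_diag g x : (1 < g)%nat ->
  refl (root g Axis) (refl (root g Diag) x) = rotz g (-1) x.
Proof.
  intros Hg.
  rewrite <- (rotz_0 g x) at 1; change 0%Z with (1 + -1)%Z.
  rewrite <- rotz_rotz, <- refl_diag_axis, !refl_refl; auto using root_unit.
Qed.

Lemma swap_refl_axis g x : (1 < g)%nat ->
  refl (root g Side) x = swap g (refl (root g Axis) (swap g x)).
Proof.
  intros Hg; assert (E := ch_sh g Hg).
  apply vec_eq; unfold refl, form; simpl; clear Hg; revert E;
    generalize (ch g) (sh g); intros; poly.
Qed.

Lemma swap_refl_diag g x : (1 < g)%nat ->
  refl (root g Diag) x = swap g (refl (root g Diag) (swap g x)).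
Proof.
  intros Hg; assert (E := ch_sh g Hg); assert (E' := sin_ang_sq g Hg).
  apply vec_eq; unfold refl, form; simpl; rewrite cos_ang by assumption; clear Hg; revert E E';
    generalize (ch g) (sh g) (sin (ang g)); intros; poly.
Qed.

Lemma iter_rotz g k n x : Nat.iter n (rotz g k) x = rotz g (Z.of_nat n * k) x.
Proof.
  induction n as [| n IH]; [symmetry; apply rotz_0 |].
  simpl Nat.iter; rewrite IH, rotz_rotz; f_equal; lia.
Qed.

Lemma iter_ext {A : Type} (f h : A -> A) n x :
  (forall y, f y = h y) -> Nat.iter n f x = Nat.iter n h x.
Proof. intros E; induction n as [| n IH]; simpl; auto; now rewrite IH, E. Qed.

Lemma iter_swap g f n x : (1 < g)%nat ->
  Nat.iter n (fun y => swap g (f (swap g y))) x = swap g (Nat.iter n f (swap g x)).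
Proof.
  intros Hg; induction n as [| n IH]; simpl; [symmetry; now apply swap_swap |].
  now rewrite IH, swap_swap.
Qed.

Lemma iter_rotz_half g x : (1 < g)%nat ->
  Nat.iter (2 * g) (rotz g 1) x = Nat.iter (2 * g) (rotz g (-1)) x.
Proof.
  intros Hg; rewrite !iter_rotz, <- (rotz_period g _ (-1)) by assumption; f_equal; lia.
Qed.

(** At the centre the braid relation says that half-turns in either sense agree. Conjugation by
    [swap] exchanges the mirrors [Axis] and [Side] and fixes [Diag], which transports the relation
    to the vertex. *)
Lemma order_spec g i j : (1 < g)%nat -> i <> j -> (1 < order g i j)%nat /\
  form (root g i) (root g j) = - cos (PI / INR (order g i j)) /\
  forall x, act g (alt i j (order g i j)) x = act g (alt j i (order g i j)) x.
Proof.
  intros Hg Hij; assert (H2 : 2 <= INR g) by (apply (le_INR 2); lia).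
  assert (Ha : PI / INR (2 * (2 * g)) = ang g)
    by (unfold ang; rewrite !mult_INR; simpl INR; f_equal; ring).
  assert (Ec := cos_ang g Hg).
  assert (BA : forall x, Nat.iter (2 * g)
     (fun y => refl (root g Axis) (refl (root g Diag) y)) x =
     Nat.iter (2 * g) (fun y => refl (root g Diag) (refl (root g Axis) y)) x).
  { intros x.
    rewrite (iter_ext _ _ _ _ (fun y => refl_axis_diag g y Hg)).
    rewrite (iter_ext _ _ _ _ (fun y => refl_diag_axis g y Hg)).
    symmetry; now apply iter_rotz_half. }
  assert (BS : forall x, Nat.iter (2 * g)
     (fun y => refl (root g Side) (refl (root g Diag) y)) x =
     Nat.iter (2 * g) (fun y => refl (root g Diag) (refl (root g Side) y)) x).
  { intros x.
    rewrite (iter_ext _ (fun y => swap g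
      (refl (root g Axis) (refl (root g Diag) (swap g y))))).
    2: { intros y; now rewrite swap_refl_axis, swap_refl_diag, swap_swap by assumption. }
    rewrite (iter_ext (fun y => refl (root g Diag) _) (fun y => swap g
      (refl (root g Diag) (refl (root g Axis) (swap g y))))).
    2: { intros y; now rewrite swap_refl_diag, swap_refl_axis, swap_swap by assumption. }
    rewrite (iter_swap g (fun y => refl (root g Axis) (refl (root g Diag) y))),
      (iter_swap g (fun y => refl (root g Diag) (refl (root g Axis) y))), BA; auto. }
  assert (H2' : PI / INR 2 = PI / 2) by (simpl; f_equal; ring).
  destruct i, j; try contradiction; cbn [order];
    rewrite ?Ha, ?H2', ?cos_PI2; (split; [lia | split; [unfold form; simpl; nra |]]);
    intros x; rewrite ?act_alt_even; auto.
  - unfold alt; simpl; apply vec_eq; unfold refl, form; simpl; ring.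
  - unfold alt; simpl; apply vec_eq; unfold refl, form; simpl; ring.
Qed.

Lemma form_lin z p x q y : form z (lin p x q y) = p * form z x + q * form z y.
Proof. unfold form, lin; simpl; ring. Qed.

(** * The orbit of the vertex under the triangle group *)

Lemma act_vert_far g w : (1 < g)%nat -> form o (act g w (vert g)) <= - ch g ^ 2.
Proof.
  intros Hg; assert (Hs := sh_pos g Hg); assert (E := ch_sh g Hg).
  assert (Ec := cos_ang g Hg).
  remember (length w) as n eqn:Hn; revert w Hn.
  induction n as [n IH] using lt_wf_ind; intros w ->.
  destruct (nat_least (fun l => exists u, length u = l /\ eqw g u w))
    as (l & (u & Hl & Eu) & Hmin).
  { exists (length w), w; auto using eqw_refl. }
  assert (Hlw : (l <= length w)%nat) by (apply Hmin; exists w; auto using eqw_refl).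
  rewrite <- (proj1 Eu).
  destruct u as [| i u _] using rev_ind.
  { unfold form; simpl; lra. }
  rewrite length_app in Hl; simpl in Hl.
  assert (Ha : ascends g (fun _ => True) u i).
  { intros v _ Ev; enough (l <= length v)%nat by lia.
    apply Hmin; exists v; split; auto; eapply eqw_trans; eauto. }
  assert (Hp := ascends_nonneg g (order g) Hg (fun i j => order_spec g i j Hg) u i Ha).
  assert (Hle : 0 <= form o (act g u (root g i))).
  { apply Hp.
    - intros; unfold form; simpl; ring.
    - intros k; destruct k; unfold form; simpl; lra. }
  assert (Hv : 0 <= form (root g i) (vert g)).
  { destruct i; unfold form; simpl; rewrite ?Ec; nra. }
  (* The last reflection subtracts a nonnegative multiple of [act g u (root g i)], so [form o] can
     only decrease. *)
  rewrite act_app; simpl; unfold refl; rewrite act_lin.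
  assert (Hi := IH (length u) ltac:(lia) u eq_refl).
  rewrite form_lin.
  assert (0 <= form (root g i) (vert g) * form o (act g u (root g i)))
    by now apply Rmult_le_pos.
  lra.
Qed.

Lemma rotz_act g k : (1 < g)%nat -> exists w, forall x, rotz g k x = act g w x.
Proof.
  intros Hg.
  assert (P : forall n : nat, exists w, forall x, rotz g (Z.of_nat n) x = act g w x).
  { intros n; induction n as [| n [w Hw]].
    - exists nil; intros x; apply rotz_0.
    - exists (w ++ Diag :: Axis :: nil); intros x; rewrite act_app; cbn [act fold_right].
      rewrite refl_diag_axis, <- Hw, rotz_rotz by assumption; f_equal; lia. }
  destruct (P (Z.to_nat (k mod (4 * Z.of_nat g)))) as [w Hw]; exists w; intros x.
  assert (Hm := Z.mod_pos_bound k (4 * Z.of_nat g) ltac:(lia)).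
  rewrite <- Hw, Z2Nat.id by lia.
  rewrite <- (rotz_period g (k mod _) (k / (4 * Z.of_nat g))) by assumption; f_equal.
  rewrite Z.add_comm; apply Z.div_mod; lia.
Qed.

(** [Axis] after the half-turn is the reflection in the line through the centre perpendicular to the
    axis. Followed by [Side], it translates by twice the inradius. *)
Lemma boost_act g : (1 < g)%nat -> exists w, forall x, boost g x = act g w x.
Proof.
  intros Hg; destruct (rotz_act g (2 * Z.of_nat g) Hg) as [w Hw].
  exists (Side :: Axis :: w); intros x; simpl; rewrite <- Hw, rotz_half by assumption.
  assert (E := ch_sh g Hg); apply vec_eq; unfold refl, form; simpl; clear Hg Hw; revert E;
    generalize (ch g) (sh g); intros; poly.
Qed.

Lemma word_act_far g w : (1 < g)%nat -> form o (word_act g w (vert g)) <= - ch g ^ 2.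
Proof.
  intros Hg; enough (exists u, forall x, word_act g w x = act g u x) as [u Hu]
    by (rewrite Hu; now apply act_vert_far).
  induction w as [| k w [u Hu]]; [now exists nil |].
  destruct (rotz_act g k Hg) as [u1 H1], (rotz_act g (- k) Hg) as [u3 H3],
    (boost_act g Hg) as [u2 H2].
  exists (u1 ++ u2 ++ u3 ++ u); intros x; rewrite !act_app, <- Hu, <- H3, <- H2, <- H1.
  reflexivity.
Qed.

(** * From the disk to the hyperboloid *)

(* The isometry from the disk to the hyperboloid. *)
Definition lift (z : C) : vec :=
  let n := fst z ^ 2 + snd z ^ 2 in
  Vec ((1 + n) / (1 - n)) (2 * fst z / (1 - n)) (2 * snd z / (1 - n)).

Lemma disk_norm (z : disk) : fst (pt z) ^ 2 + snd (pt z) ^ 2 < 1.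
Proof.
  destruct z as [[a b] H]; simpl pt.
  assert (E := Cmod2_alt (a, b)); assert (P := Cmod_ge_0 (a, b)); simpl in E |- *.
  set (m := Cmod (a, b)) in *; nra.
Qed.

Lemma lift_hyp z : hyp (lift (pt z)).
Proof.
  assert (H := disk_norm z); destruct (pt z) as [a b]; simpl in H.
  assert (P := pow2_ge_0 a); assert (Q := pow2_ge_0 b); simpl in P, Q.
  split; unfold form; simpl.
  - field; lra.
  - apply Rdiv_lt_0_compat; lra.
Qed.

Lemma lift_surj x : hyp x -> exists z : disk, lift (pt z) = x.
Proof.
  intros [Hx Hx0]; unfold form in Hx; destruct x as [x y z]; simpl in *.
  assert (H : Cmod (y / (1 + x), z / (1 + x)) < 1).
  { assert (E := Cmod2_alt (y / (1 + x), z / (1 + x))); simpl fst in E; simpl snd in E.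
    assert (P := Cmod_ge_0 (y / (1 + x), z / (1 + x))).
    set (m := Cmod _) in *.
    assert (E2 : (y / (1 + x)) ^ 2 + (z / (1 + x)) ^ 2 = 1 - 2 / (1 + x)).
    { replace ((y / (1 + x)) ^ 2 + (z / (1 + x)) ^ 2) with ((y * y + z * z) / (1 + x) ^ 2)
        by (field; lra).
      replace (y * y + z * z) with (x * x - 1) by lra; field; lra. }
    assert (0 < 2 / (1 + x)) by (apply Rdiv_lt_0_compat; lra).
    simpl in E, E2. nra. }
  exists (exist (fun z => Cmod z < 1) _ H); unfold lift; simpl.
  assert (E2 : (y / (1 + x)) * ((y / (1 + x)) * 1) + (z / (1 + x)) * ((z / (1 + x)) * 1)
     = 1 - 2 / (1 + x)).
    { replace (_ + _) with ((y * y + z * z) / (1 + x) ^ 2)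
        by (field; lra).
      replace (y * y + z * z) with (x * x - 1) by lra; field; lra. }
  rewrite E2; f_equal; field; lra.
Qed.

Lemma lift_inj z w : lift (pt z) = lift (pt w) -> z = w.
Proof.
  intros E; assert (Hz := disk_norm z); assert (Hw := disk_norm w).
  enough (Ez : pt z = pt w).
  { destruct z as [z Pz], w as [w Pw]; simpl in Ez; subst w; f_equal.
    apply Classical_Prop.proof_irrelevance. }
  destruct (pt z) as [a b], (pt w) as [a' b']; unfold lift in E; simpl fst in *; simpl snd in *.
  assert (E0 := f_equal v0 E); assert (E1 := f_equal v1 E); assert (E2 := f_equal v2 E).
  cbn [v0 v1 v2 fst snd] in E0, E1, E2; clear E.
  set (n := a ^ 2 + b ^ 2) in *; set (n' := a' ^ 2 + b' ^ 2) in *.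
  assert (En : n = n').
  { assert (H : (1 + n) * (1 - n') = (1 + n') * (1 - n)); [| lra].
    transitivity ((1 + n) / (1 - n) * ((1 - n) * (1 - n'))); [field; lra |].
    rewrite E0; field; lra. }
  rewrite <- En in E1, E2.
  assert (F : forall r r', 2 * r / (1 - n) = 2 * r' / (1 - n) -> r = r').
  { intros r r' H; transitivity (2 * r / (1 - n) * (1 - n) / 2); [field; lra |].
    rewrite H; field; lra. }
  now rewrite (F _ _ E1), (F _ _ E2).
Qed.

Lemma cosh_2artanh r : 0 <= r < 1 -> cosh (2 * artanh r) = (1 + r ^ 2) / (1 - r ^ 2).
Proof.
  intros Hr; unfold artanh, cosh.
  replace (2 * (ln ((1 + r) / (1 - r)) / 2)) with (ln ((1 + r) / (1 - r))) by field.
  assert (H : 0 < (1 + r) / (1 - r)) by (apply Rdiv_lt_0_compat; lra).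
  rewrite exp_Ropp, exp_ln by assumption; field; split; [nra | lra].
Qed.

Lemma cosh_hdist z w : cosh (hdist z w) = - form (lift (pt z)) (lift (pt w)).
Proof.
  assert (Hz := disk_norm z); assert (Hw := disk_norm w).
  unfold hdist; destruct (pt z) as [a b], (pt w) as [a' b'].
  simpl fst in *; simpl snd in *.
  set (u := ((a, b) - (a', b'))%C); set (v := (1 - Cconj (a, b) * (a', b'))%C).
  assert (Eu : Cmod u ^ 2 = (a - a') ^ 2 + (b - b') ^ 2)
    by (rewrite Cmod2_alt; simpl; ring).
  assert (Ev : Cmod v ^ 2 = (1 - (a * a' + b * b')) ^ 2 + (a * b' - b * a') ^ 2)
    by (rewrite Cmod2_alt; simpl; ring).
  assert (Ed : Cmod v ^ 2 - Cmod u ^ 2 = (1 - (a ^ 2 + b ^ 2)) * (1 - (a' ^ 2 + b' ^ 2)))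
    by (rewrite Eu, Ev; ring).
  assert (Hp : 0 < (1 - (a ^ 2 + b ^ 2)) * (1 - (a' ^ 2 + b' ^ 2)))
    by (apply Rmult_lt_0_compat; lra).
  assert (Hlt : Cmod u < Cmod v) by (apply Cmod_lt_of_sqr; lra).
  assert (Pu := Cmod_ge_0 u).
  rewrite cosh_2artanh by (split; [apply Cmod_ge_0 | now apply Cmod_quot_lt1]).
  assert (Hv : v <> RtoC 0) by (apply Cmod_gt_0; lra).
  rewrite Cmod_div by assumption.
  replace ((1 + (Cmod u / Cmod v) ^ 2) / (1 - (Cmod u / Cmod v) ^ 2))
    with ((Cmod v ^ 2 + Cmod u ^ 2) / (Cmod v ^ 2 - Cmod u ^ 2))
    by (field; repeat split; nra).
  rewrite Ed, Eu, Ev; unfold form, lift; simpl; field; simpl in *; lra.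
Qed.

Lemma tanh_half_side g : (1 < g)%nat -> tanh (side g / 2) = sh g / ch g.
Proof.
  intros Hg; assert (Hc := ch_gt1 g Hg); assert (Hs := sh_pos g Hg).
  assert (E := ch_sh g Hg).
  unfold side; fold (ang g); fold (ch g).
  replace (2 * arcosh (ch g) / 2) with (arcosh (ch g)) by field.
  unfold arcosh; fold (sh g).
  unfold tanh, sinh, cosh; rewrite exp_Ropp, exp_ln by lra.
  replace (/ (ch g + sh g)) with (ch g - sh g); [field; lra |].
  apply Rmult_eq_reg_l with (ch g + sh g); [rewrite Rinv_r by lra; nra | lra].
Qed.

(** In homogeneous coordinates [lift] is a quotient of quadratic expressions, so that a Mobius map
    induces a linear one. *)
Lemma lift_quot (u v : C) : Cmod u < Cmod v ->
  let d := Cmod v ^ 2 - Cmod u ^ 2 in let p := (u * Cconj v)%C in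
  lift (u / v)%C = Vec ((Cmod v ^ 2 + Cmod u ^ 2) / d) (2 * fst p / d) (2 * snd p / d).
Proof.
  intros H d p; assert (Pu := Cmod_ge_0 u).
  assert (Hd : 0 < d) by (unfold d; nra).
  assert (Hv : 0 < Cmod v ^ 2) by nra.
  unfold d, p in *; clear d p; rewrite !Cmod2_alt in *.
  destruct u as [a b], v as [a' b']; simpl in *.
  assert (Hn : fst ((a, b) / (a', b'))%C ^ 2 + snd ((a, b) / (a', b'))%C ^ 2
     = (a ^ 2 + b ^ 2) / (a' ^ 2 + b' ^ 2)) by (simpl; field; simpl; lra).
  unfold lift; rewrite Hn; simpl; f_equal; field; lra.
Qed.

Lemma lift_t_mx g k z : (1 < g)%nat ->
  lift (pt (mobius (t_mx g k) z)) = trans g (Z.of_nat k) (lift (pt z)).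
Proof.
  intros Hg; assert (Hc := ch_gt1 g Hg); assert (E := ch_sh g Hg).
  assert (Hz := disk_norm z); destruct z as [[a b] Pz]; simpl pt in *.
  simpl fst in Hz; simpl snd in Hz.
  assert (Ht : INR k * PI / (2 * INR g) = 2 * ang g * IZR (Z.of_nat k)).
  { rewrite <- INR_IZR_INZ; unfold ang; field.
    apply not_0_INR; lia. }
  assert (Hq : forall q : R, q = - (2 * ang g * IZR (Z.of_nat k)) ->
    2 * ang g * IZR (- Z.of_nat k) = q) by (intros q ->; rewrite opp_IZR; ring).
  unfold trans, rotz; rewrite (Hq _ eq_refl).
  set (t := 2 * ang g * IZR (Z.of_nat k)).
  set (C := cos t); set (S := sin t).
  assert (ECS : C ^ 2 + S ^ 2 = 1) by (generalize (sin2_cos2 t); unfold Rsqr, C, S; lra).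
  set (tau := sh g / ch g).
  assert (Ecis : cis (- t) = (C, - S)) by (unfold cis; now rewrite cos_neg, sin_neg).
  assert (Htau : ch g ^ 2 * (1 - tau ^ 2) = 1)
    by (unfold tau; replace (ch g ^ 2 * _) with (ch g ^ 2 - sh g ^ 2) by (field; lra); lra).
  (* [i] is [1 / (1 - tau ^ 2)], so the entries of [boost] become polynomials in [i] and [tau]
     subject to [Htau]. *)
  set (i := ch g ^ 2) in *.
  assert (Es : ch g ^ 2 + sh g ^ 2 = i * (1 + tau ^ 2)) by (unfold i, tau; field; lra).
  assert (Ecs : 2 * ch g * sh g = 2 * i * tau) by (unfold i, tau; field; lra).
  assert (Ht1 : 0 < 1 - tau ^ 2) by (assert (0 < i) by (unfold i; nra); nra).
  assert (Hz1 : 0 < 1 - (a ^ 2 + b ^ 2)) by lra.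
  change (pt (mobius (t_mx g k) (exist (fun z => Cmod z < 1) (a, b) Pz))) with
    ((RtoC 1 * (a, b) + Cconj (tanh (side g / 2) * cis (- (INR k * PI / (2 * INR g)))))
     / (tanh (side g / 2) * cis (- (INR k * PI / (2 * INR g))) * (a, b) + Cconj (RtoC 1)))%C.
  rewrite Ht, tanh_half_side by assumption; fold t tau; rewrite Ecis.
  assert (Ed : forall n1 n2, n1 = Cmod (tau * (C, (- S)%R) * (a, b) + Cconj (RtoC 1))%C ^ 2 ->
    n2 = Cmod (RtoC 1 * (a, b) + Cconj (tau * (C, (- S)%R)))%C ^ 2 ->
    n1 - n2 = (1 - tau ^ 2) * (1 - (a ^ 2 + b ^ 2))).
  { intros n1 n2 -> ->; rewrite !Cmod2_alt; simpl; clear - ECS.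
    generalize dependent C; generalize dependent S; generalize tau; intros; poly. }
  specialize (Ed _ _ eq_refl eq_refl).
  rewrite lift_quot.
  2: { apply Cmod_lt_of_sqr; nra. }
  cbv zeta; rewrite Ed.
  unfold boost; cbv zeta; rewrite Es, Ecs.
  assert (Q : forall p r, p = (1 - tau ^ 2) * r ->
    p / ((1 - tau ^ 2) * (1 - (a ^ 2 + b ^ 2))) = r / (1 - (a ^ 2 + b ^ 2)))
    by (intros p r ->; field; lra).
  set (n := a ^ 2 + b ^ 2) in *.
  unfold rot, lift; cbn [v0 v1 v2 fst snd]; fold n; rewrite cos_neg, sin_neg; fold C S.
  apply vec_eq; cbn [v0 v1 v2].
  - rewrite (Q _ (i * (1 + tau ^ 2) * (1 + n)
      + 2 * i * tau * (C * (2 * a) + S * (2 * b)))); [field; lra |].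
    rewrite !Cmod2_alt; simpl; unfold n; clear - ECS Htau.
    generalize dependent C; generalize dependent S; generalize dependent i;
    generalize tau; intros; poly.
  - rewrite (Q _ (C * (2 * i * tau * (1 + n) + i * (1 + tau ^ 2) * (C * (2 * a) + S * (2 * b)))
      - S * (- S * (2 * a) + C * (2 * b)))); [field; lra |].
    simpl; unfold n; clear - ECS Htau.
    generalize dependent C; generalize dependent S; generalize dependent i;
    generalize tau; intros; poly.
  - rewrite (Q _ (S * (2 * i * tau * (1 + n) + i * (1 + tau ^ 2) * (C * (2 * a) + S * (2 * b)))
      + C * (- S * (2 * a) + C * (2 * b)))); [field; lra |].
    simpl; unfold n; clear - ECS Htau.
    generalize dependent C; generalize dependent S; generalize dependent i;
    generalize tau; intros; poly.
Qed.

Lemma trans_period g k l x : (1 < g)%nat -> trans g (k + 4 * Z.of_nat g * l) x = trans g k x.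
Proof.
  intros Hg; unfold trans.
  replace (- (k + 4 * Z.of_nat g * l))%Z with (- k + 4 * Z.of_nat g * (- l))%Z by ring.
  now rewrite !rotz_period.
Qed.

(** Modulo [4g], directions below [2g] are generators and the others are their inverses. *)
Lemma bolza_trans g k : (1 < g)%nat ->
  exists h, bolza_group g h /\ forall z, lift (pt (h z)) = trans g k (lift (pt z)).
Proof.
  intros Hg; set (r := (k mod (4 * Z.of_nat g))%Z).
  assert (Hr := Z.mod_pos_bound k (4 * Z.of_nat g) ltac:(lia)); fold r in Hr.
  assert (Hk : forall x, trans g k x = trans g r x).
  { intros x; rewrite <- (trans_period g r (k / (4 * Z.of_nat g))) by assumption; f_equal.
    rewrite Z.add_comm; apply Z.div_mod; lia. }
  assert (Er : Z.of_nat (Z.to_nat r) = r) by (apply Z2Nat.id; lia).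
  exists (mobius (t_mx g (Z.to_nat r))); split.
  2: { intros z; now rewrite lift_t_mx, Er, Hk. }
  destruct (Nat.lt_ge_cases (Z.to_nat r) (2 * g)) as [L | L].
  { apply gen_base; exists (Z.to_nat r); auto. }
  set (m := (Z.to_nat r - 2 * g)%nat).
  assert (Em : Z.of_nat (Z.to_nat r) = (Z.of_nat m + 2 * Z.of_nat g)%Z) by lia.
  apply (gen_inv _ (mobius (t_mx g m))).
  - apply gen_base; exists m; split; auto; lia.
  - intros z; apply lift_inj; now rewrite !lift_t_mx, Em, trans_inv.
  - intros z; apply lift_inj; now rewrite !lift_t_mx, Em, trans_inv_l.
Qed.

Lemma bolza_word g w : (1 < g)%nat ->
  exists h, bolza_group g h /\ forall z, lift (pt (h z)) = word_act g w (lift (pt z)).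
Proof.
  intros Hg; induction w as [| k w (h & Gh & Hh)].
  - exists (fun z => z); split; [apply gen_id | reflexivity].
  - destruct (bolza_trans g k Hg) as (f & Gf & Hf).
    exists (fun z => f (h z)); split; [now apply gen_comp |].
    intros z; now rewrite Hf, Hh.
Qed.

Lemma word_bolza g h : (1 < g)%nat -> bolza_group g h ->
  exists w, forall z, lift (pt (h z)) = word_act g w (lift (pt z)).
Proof.
  intros Hg Gh.
  induction Gh as [| f (k & Hk & ->) | f h Gf [u Hu] Gh [w Hw] | f h Gf [u Hu] H1 H2].
  - now exists nil.
  - exists (Z.of_nat k :: nil); intros z; now apply lift_t_mx.
  - exists (u ++ w); intros z; now rewrite Hu, Hw, word_act_app.
  - destruct (word_act_inv g u Hg) as [u' Hu']; exists u'; intros z.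
    rewrite <- (H2 z) at 2; rewrite Hu; symmetry; apply Hu'.
Qed.

(** * The diameter *)

Lemma cosh_le_inv x y : 0 <= x -> 0 <= y -> cosh x <= cosh y -> x <= y.
Proof.
  intros Hx Hy H; apply Rnot_lt_le; intros L; generalize (cosh_incr y x Hy L); lra.
Qed.

Definition to_surface (g : nat) (z : disk) : surface g :=
  exist _ (orbit g z) (ex_intro _ z eq_refl).

Theorem theorem1 :
  forall g : nat, (1 < g)%nat ->
    is_diameter g (arcosh (cot (PI / (4 * INR g)) ^ 2)).
Proof.
  intros g Hg; fold (ang g); fold (ch g).
  assert (Hc := ch_gt1 g Hg).
  destruct (arcosh_spec (ch g ^ 2)) as [HD0 HD]; [nra |].
  set (D := arcosh (ch g ^ 2)) in *; split.
  (* The diameter is attained by the classes of the centre and of a vertex. *)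
  - destruct (lift_surj o hyp_o) as [z Hz].
    destruct (lift_surj (vert g)) as [v Hv];
      [rewrite <- swap_o; apply hyp_swap, hyp_o; assumption |].
    exists (to_surface g z), (to_surface g v); unfold sdist.
    enough (G : is_glb_Rbar (orbit_dists (to_surface g z) (to_surface g v)) (Finite D))
      by now rewrite (is_glb_Rbar_unique _ _ G).
    split.
    + intros d (z' & v' & (f & Gf & ->) & (h & Gh & ->) & ->).
      apply cosh_le_inv; auto using hdist_ge0.
      destruct (word_bolza g f Hg Gf) as [u Hu], (word_bolza g h Hg Gh) as [w Hw].
      destruct (word_act_inv g u Hg) as [u' Hu'].
      rewrite HD, cosh_hdist, Hu, Hw, Hz, Hv.
      (* The inverse word [u'] returns the first point to [o] and leaves a single word acting on the
         vertex. *)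
      rewrite <- (word_act_isometry g u' Hg), (proj1 (Hu' o)), <- word_act_app.
      generalize (word_act_far g (u' ++ w) Hg); lra.
    + intros b Hb; apply Hb; exists z, v; repeat split.
      * exists (fun x => x); split; [apply gen_id | reflexivity].
      * exists (fun x => x); split; [apply gen_id | reflexivity].
      * apply cosh_inj; auto using hdist_ge0.
        rewrite HD, cosh_hdist, Hz, Hv; unfold form; simpl; ring.
  - intros p q; destruct (sdist_glb g p q) as [Hlow _].
    destruct p as [P [z Ez]], q as [Q [w Ew]].
    set (d := sdist _ _) in *.
    apply Rnot_lt_le; intros L; assert (Hcd := cosh_incr D d HD0 L).
    (* Half the excess of [cosh d] over [ch g ^ 2] as slack yields orbit points strictly closer than
       [d]. *)
    destruct (covering_bound g (lift (pt z)) (lift (pt w)) ((cosh d - ch g ^ 2) / 2) Hg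
      (lift_hyp z) (lift_hyp w)) as (u & v & Huv); [lra |].
    destruct (bolza_word g u Hg) as (f & Gf & Hf), (bolza_word g v Hg) as (h & Gh & Hh).
    rewrite <- Hf, <- Hh, <- cosh_hdist in Huv.
    assert (Hd : d <= hdist (f z) (h w)).
    { apply Hlow; exists (f z), (h w); unfold on; simpl; rewrite Ez, Ew.
      repeat split; [now exists f | now exists h]. }
    destruct Hd as [Hd | Hd].
    + assert (H := cosh_incr d (hdist (f z) (h w)) ltac:(lra) Hd); lra.
    + rewrite <- Hd in Huv; lra.
Qed.
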